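(* Let $\varphi : \varGamma \to \varGamma'$ be a finite harmonic morphism between tropical curves. Then $\operatorname{Rat}(\varGamma)$ is finitely generated as a $\varphi^{\ast}(\operatorname{Rat}(\varGamma'))$-algebra, where $\varphi^{\ast}(\operatorname{Rat}(\varGamma')) = \{ f' \circ \varphi \mid f' \in \operatorname{Rat}(\varGamma') \} \subset \operatorname{Rat}(\varGamma)$ is the pull-back of $\operatorname{Rat}(\varGamma')$ by $\varphi$.
   Context: Graphs are unweighted, undirected, finite, connected, nonempty multigraphs that may have loops. The valence of a vertex is the number of incident edges, loops counted twice; a leaf end is a vertex of valence one; a leaf edge is an edge incident to a leaf end. An edge-weighted graph $(G,l)$ is a graph $G$ with a function $l : E(G) \to \boldsymbol{R}_{>0} \cup \{\infty\}$ that takes the value $\infty$ only on leaf edges. A tropical curve is the underlying topological space of an edge-weighted graph $(G,l)$ together with an identification of each edge $e$ with $[0,l(e)]$, where $[0,\infty]$ is the one-point compactification of $[0,\infty)$; if $l(e)=\infty$, the leaf end of $e$ is identified with $\infty$ (if $E(G)=\{e\}$ and $l(e)=\infty$, either leaf end may be identified with $\infty$). Then $(G,l)$ is called a model for the tropical curve; a tropical curve has many models, and vertices and edges of $G$ are identified with the corresponding points and closed subsets. A model is loopless if $G$ has no loops. Points identified with $\infty$ are called points at infinity; all other points are finite points. Distances are path distances, and the distance between a point at infinity and any other point is infinite. A rational function on $\varGamma$ is either the constant function $-\infty$, or a continuous map $f : \varGamma \to \boldsymbol{R} \cup \{\pm\infty\}$ that is piecewise affine with integer slopes and finitely many pieces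 and that takes the values $\pm\infty$ only at points at infinity. $\operatorname{Rat}(\varGamma)$ is the set of all rational functions on $\varGamma$, with $(f \oplus g)(x) = \max\{f(x),g(x)\}$ and $(f \odot g)(x) = f(x)+g(x)$ at finite points $x$, extended continuously to points at infinity (and $f \odot (-\infty) = -\infty$). This is a semifield with zero element $-\infty$ and unit the constant function $0$. A continuous map $\varphi : \varGamma \to \varGamma'$ between tropical curves is a finite harmonic morphism if there exist loopless models $(G,l)$ and $(G',l')$ for $\varGamma$ and $\varGamma'$ such that: (1) $\varphi(V(G)) \subset V(G')$; (2) $\varphi(E(G)) \subset E(G')$; (3) for each edge $e$ of $G$ there is a positive integer $\deg_e(\varphi)$ such that $\operatorname{dist}(\varphi(x),\varphi(y)) = \deg_e(\varphi)\cdot\operatorname{dist}(x,y)$ for all points $x,y$ of $e$; (4) for every vertex $v$ of $G$, the sum $\sum_{e \in E(G):\, e \mapsto e',\, v \in e} \deg_e(\varphi)$ is independent of the choice of $e' \in E(G')$ incident to $\varphi(v)$. If both $\varGamma$ and $\varGamma'$ are singletons, $\varphi$ is regarded as a finite harmonic morphism. For a subsemiring $S$ of a semiring $A$, $A$ is finitely generated as an $S$-algebra if there is a finite subset of $A$ such that the smallest subsemiring of $A$ containing $S$ and this subset is $A$ (so only sums and products, not inverses, are used). *)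

(* Defs.v *)
From mathcomp Require Export all_boot all_order all_algebra.
From mathcomp Require Export all_classical all_reals all_analysis.

Set Implicit Arguments.
Unset Strict Implicit.
Unset Printing Implicit Defensive.

Import Order.TTheory GRing.Theory Num.Theory.
Import numFieldNormedType.Exports.

Local Open Scope classical_set_scope.
Local Open Scope ring_scope.

(* Edges are undirected: [src] and [tgt] only name the two ends of an edge,
   so that the edge can be identified with an interval.  A loop is an edge
   whose two ends coincide. *)
Record multigraph := Multigraph {
  vertex : finType;
  edge : finType;
  src : edge -> vertex;
  tgt : edge -> vertex }.

Section Multigraph.
Variable G : multigraph.

Definition adjacent : rel (vertex G) := fun u v =>
  [exists e : edge G, ((src e == u) && (tgt e == v))
                   || ((src e == v) && (tgt e == u))].

Definition graph_connected : Prop := forall u v, connect adjacent u v.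

Definition loopless : Prop := forall e : edge G, src e != tgt e.

Definition valence (v : vertex G) : nat :=
  (#|[set e : edge G | src e == v]%SET| + #|[set e : edge G | tgt e == v]%SET|)%N.

Definition leaf_end (v : vertex G) : bool := valence v == 1%N.

Definition leaf_edge (e : edge G) : bool :=
  leaf_end (src e) || leaf_end (tgt e).

End Multigraph.

Record edge_weighted_graph (R : realType) := EdgeWeightedGraph {
  ewg_graph :> multigraph;
  len : edge ewg_graph -> \bar R;
  ewg_nonempty : (0 < #|vertex ewg_graph|)%N;
  ewg_connected : graph_connected ewg_graph;
  len_gt0 : forall e, (0 < len e)%E;
  len_pinfty : forall e, len e = +oo%E -> leaf_edge e }.

(* An edge-weighted graph together with an identification of its geometric
   realization with the space T: [vpt v] is the point of the vertex v, and
   [ept e] is the parametrization of the edge e by [0, len e], a subspace of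
   \bar R (so that [0, +oo] is the one-point compactification of [0, +oo[).
   The values of [ept e] outside [0, len e] are irrelevant. *)
Record model (R : realType) (T : topologicalType) := Model {
  model_graph :> edge_weighted_graph R;
  vpt : vertex model_graph -> T;
  ept : edge model_graph -> \bar R -> T;
  (* an edge of infinite length has its leaf end at infinity; when both ends
     are leaf ends, either of them can be called [tgt] *)
  model_pinfty : forall e : edge model_graph, len e = +oo%E -> leaf_end (tgt e);
  ept_src : forall e : edge model_graph, ept e 0%E = vpt (src e);
  ept_tgt : forall e : edge model_graph, ept e (len e) = vpt (tgt e);
  vpt_inj : injective vpt;
  ept_neq_vpt : forall (e : edge model_graph) (t : \bar R) v,
    (0 < t < len e)%E -> ept e t <> vpt v;
  ept_inj : forall (e e' : edge model_graph) (t t' : \bar R),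
    (0 < t < len e)%E -> (0 < t' < len e')%E ->
    ept e t = ept e' t' -> e = e' /\ t = t';
  model_cover : forall x, (exists v, x = vpt v) \/
    (exists (e : edge model_graph) (t : \bar R), (0 < t < len e)%E /\ x = ept e t);
  (* T carries the quotient topology *)
  model_open : forall A : set T, open A <->
    forall e : edge model_graph, @open (subspace `[0%E, len e]) (ept e @^-1` A) }.

Section Model.
Variables (R : realType) (T : topologicalType) (M : model R T).

Definition edge_set (e : edge M) : set T := ept e @` `[0%E, len e].

(* [walk x y L]: there is a path of length L from x to y, made of finitely
   many segments, each running inside one edge.  In a segment with
   s = t = +oo, `|s - t| is +oo, which does not change the infimum below. *)
Inductive walk : T -> T -> \bar R -> Prop :=
| walk_nil x : walk x x 0%E
| walk_cons (e : edge M) (s t : \bar R) y L :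
    (0 <= s <= len e)%E -> (0 <= t <= len e)%E ->
    walk (ept e t) y L -> walk (ept e s) y (`|s - t| + L)%E.

Definition model_dist (x y : T) : \bar R :=
  ereal_inf [set L | walk x y L].

End Model.

(* A tropical curve is given by one model.  The identification of the edges
   with intervals is remembered through the path distance only, so the other
   models of the curve are those of the same space that induce the same
   distance. *)
Record tropical_curve (R : realType) := TropicalCurve {
  curve_space :> topologicalType;
  curve_model : model R curve_space }.

Section TropicalCurve.
Variables (R : realType) (Gam : tropical_curve R).

Definition curve_dist : Gam -> Gam -> \bar R := model_dist (curve_model Gam).

Definition is_model (M : model R Gam) : Prop :=
  forall x y, model_dist M x y = curve_dist x y.

Definition point_at_infinity (x : Gam) : Prop :=
  exists e : edge (curve_model Gam), len e = +oo%E /\ x = ept e +oo%E.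

Definition finite_point (x : Gam) : Prop := ~ point_at_infinity x.

Definition singleton_curve : Prop := exists x : Gam, forall y : Gam, y = x.

(* g is piecewise affine on the finite part of [0, l], with integer slopes
   and with finitely many pieces, which are intervals. *)
Definition piecewise_integer_affine (l : \bar R) (g : R -> \bar R) : Prop :=
  exists s : seq (interval R),
    (forall t : R, (0 <= t%:E <= l)%E -> exists2 i, i \in s & t \in i) /\
    (forall i, i \in s -> exists (k : int) (c : R),
       forall t : R, (0 <= t%:E <= l)%E -> t \in i ->
         g t = (k%:~R * t + c)%:E).

Definition rational (f : Gam -> \bar R) : Prop :=
  f = cst -oo%E \/
  [/\ continuous f,
      forall e : edge (curve_model Gam),
        piecewise_integer_affine (len e) (fun t => f (ept e t%:E)) &
      forall x, finite_point x -> f x \is a fin_num].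

Definition Rat : set (Gam -> \bar R) := [set f | rational f].

Definition rat_add (f g : Gam -> \bar R) : Gam -> \bar R :=
  fun x => maxe (f x) (g x).

Definition rat_mul (f g : Gam -> \bar R) : Gam -> \bar R :=
  fun x => if `[< finite_point x >] then (f x + g x)%E
           else lim ((f y + g y)%E @[y --> x^']).

Definition rat_zero : Gam -> \bar R := cst -oo%E.

Definition rat_one : Gam -> \bar R := cst 0%E.

Definition subsemiring (B : set (Gam -> \bar R)) : Prop :=
  [/\ B `<=` Rat, B rat_zero, B rat_one,
      (forall f g, B f -> B g -> B (rat_add f g)) &
      (forall f g, B f -> B g -> B (rat_mul f g))].

Definition finitely_generated_algebra (S : set (Gam -> \bar R)) : Prop :=
  subsemiring S /\
  exists F : set (Gam -> \bar R),
    [/\ finite_set F, F `<=` Rat & smallest subsemiring (S `|` F) = Rat].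

End TropicalCurve.

Section Harmonic.
Variables (R : realType) (Gam Gam' : tropical_curve R).

Definition harmonic_for (M : model R Gam) (M' : model R Gam')
    (phi : Gam -> Gam') (deg : edge M -> nat) : Prop :=
  [/\ forall v : vertex M, exists v' : vertex M', phi (vpt v) = vpt v',
      forall e : edge M, exists e' : edge M',
        phi @` edge_set e = edge_set e',
      forall e : edge M, (0 < deg e)%N /\
        forall x y, edge_set e x -> edge_set e y ->
          curve_dist (phi x) (phi y) = ((deg e)%:R%:E * curve_dist x y)%E &
      forall v : vertex M, exists d : nat, forall e' : edge M',
        edge_set e' (phi (vpt v)) ->
        (\sum_(e : edge M | `[< phi @` edge_set e = edge_set e' /\
                                edge_set e (vpt v) >]) deg e)%N = d].

(* The map from a one-point curve to a larger curve satisfies the conditions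
   on models vacuously; it is not a finite harmonic morphism. *)
Definition finite_harmonic (phi : Gam -> Gam') : Prop :=
  continuous phi /\
  ((singleton_curve Gam /\ singleton_curve Gam') \/
   (~ singleton_curve Gam /\
    exists (M : model R Gam) (M' : model R Gam') (deg : edge M -> nat),
      [/\ is_model M, is_model M', loopless M, loopless M' &
          harmonic_for M' phi deg])).

Definition pullback_Rat (phi : Gam -> Gam') : set (Gam -> \bar R) :=
  [set f' \o phi | f' in @Rat R Gam'].

End Harmonic.

(* Main.v *)
Require Import Defs.
From mathcomp Require Import ring lra.

(** Let [d] and [d'] be the path distances of [Gam] and [Gam'].  The proof
    rests on two consequences of harmonicity: [phi] is Lipschitz, and [Gam] is
    covered by finitely many cells, that is, closed parts of half edges, on
    each of which [phi] multiplies distances by a positive integer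
    ([cells_exist]).

    Consider a rational function [f], different from the constant -oo, and an
    arc [A], with ends [p] and [q], of a cell [C] of the edge [e], such that
    [f] is affine on [A].  The tent over [e], the distance [psi] to the ends
    of [e], has slope 1 or -1 on each half edge, so that [f = k psi + b] on [A]
    for an integer [k].  On [Gam'] the function
      [W y = d' y (phi p) + d' y (phi q) - d' (phi p) (phi q)]
    is rational, because distances to finite points are ([Ratfin_dist]), and
    since [phi] is a dilation on [C], its pullback vanishes on [A] and
    dominates the distance to [A] on [C] ([wedge]).  Outside [C] the pullback
    may vanish again; the distance [G] to [C] makes up for this.  The function
    [k psi + b - f] is Lipschitz and vanishes on [A], hence
      [k psi + b - n1 (W o phi) - n2 G <= f]
    everywhere for large natural numbers [n1] and [n2], with equality on [A]
    ([piece_below]).  As [f] has finitely many pieces, it is the maximum of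
    finitely many functions of this form.  They are products of constants and
    of pullbacks with powers of [psi], [- psi] and [- G]; these generators
    depend on the cell but not on [f], so there are finitely many of them.

    All estimates take place at finite points and in [R].  The class [Ratfin]
    of real functions that are Lipschitz and piecewise affine with integer
    slopes along the edges consists of the restrictions of the rational
    functions other than -oo ([rational_ext], [Ratfin_fine]), and a rational
    function is determined by its restriction ([rat_eq_finite]).  This disposes
    of the points at infinity and of the limits in [rat_mul].

    That pullbacks of rational functions are rational also comes from the
    cells: cut at finitely many more points, they are mapped into half edges
    of [Gam'], where a dilation is an affine map of the parameters. *)

Set Implicit Arguments.
Unset Strict Implicit.
Unset Printing Implicit Defensive.
Import Order.TTheory GRing.Theory Num.Theory.
Import numFieldNormedType.Exports.
Local Open Scope classical_set_scope.
Local Open Scope ring_scope.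

(** * Piecewise affine functions of a real variable *)

Section PiecewiseAffine.
Variable R : realType.
Implicit Types (D J : set R) (g u v : R -> R).

Definition affine_on D g := exists (k : int) (c : R),
  forall t, D t -> g t = k%:~R * t + c.

(** The pieces form a family over a finite type, so that refinements are indexed
    by products and gluings by dependent sums.  They may overlap and need
    not be ordered. *)
Definition pl D g := exists (I : finType) (A : I -> set R),
  [/\ forall t, D t -> exists i, A i t,
      forall i, is_interval (A i) &
      forall i, affine_on (D `&` A i) g].

Lemma is_intervalI (A B : set R) :
  is_interval A -> is_interval B -> is_interval (A `&` B).
Proof.
move=> hA hB x y [Ax Bx] [Ay By] z xzy.
by split; [exact: (hA x y Ax Ay z xzy)|exact: (hB x y Bx By z xzy)].
Qed.

Lemma affine_on_pl D g : affine_on D g -> pl D g.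
Proof.
move=> [k [c h]]; exists unit, (fun=> setT); split=> [t _|i|i].
- by exists tt.
- by [].
- by exists k, c => t [/h].
Qed.

Lemma pl_set1 D g a : D `<=` [set a] -> pl D g.
Proof.
by move=> Da; apply: affine_on_pl; exists 0, (g a) => t /Da ->; rewrite mul0r add0r.
Qed.

Lemma pl_sub D D' g : D' `<=` D -> pl D g -> pl D' g.
Proof.
move=> DD' [I [A [cA iA aA]]]; exists I, A; split=> // [t /DD'/cA //|i].
by have [k [c h]] := aA i; exists k, c => t [/DD' Dt At]; apply: h.
Qed.

Lemma pl_ext D g g' : (forall t, D t -> g t = g' t) -> pl D g -> pl D g'.
Proof.
move=> gg' [I [A [cA iA aA]]]; exists I, A; split=> // i.
by have [k [c h]] := aA i; exists k, c => t Dt; rewrite -h// gg'//; case: Dt.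
Qed.

(** The bridge between functions given by cases on intervals and [pl]. *)
Lemma pl_glue D g (I : finType) (J : I -> set R) :
  (forall t, D t -> exists i, J i t) -> (forall i, is_interval (J i)) ->
  (forall i, pl (D `&` J i) g) -> pl D g.
Proof.
move=> cJ iJ pJ.
have /choice[F hF] : forall i, exists X : {K : finType & K -> set R},
    [/\ forall t, (D `&` J i) t -> exists j, projT2 X j t,
      forall j, is_interval (projT2 X j) &
      forall j, affine_on (D `&` J i `&` projT2 X j) g].
  by move=> i; have [K [A hA]] := pJ i; exists (existT _ K A).
exists {i : I & projT1 (F i)}, (fun x => J (tag x) `&` projT2 (F (tag x)) (tagged x)).
split=> [t Dt|[i j]|[i j]].
- have [i Jt] := cJ _ Dt; have [+ _ _] := hF i.
  move=> /(_ t (conj Dt Jt))[j hj].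
  by exists (Tagged (fun i => projT1 (F i)) j).
- by apply: is_intervalI => //=; have [_ + _] := hF i; apply.
- by rewrite setIA /=; have [_ _] := hF i; apply.
Qed.

(** Two piecewise affine functions are affine on the pairwise intersections of
    their pieces. *)
Lemma pl2 D u v : pl D u -> pl D v -> exists (I : finType) (A : I -> set R),
  [/\ forall t, D t -> exists i, A i t,
      forall i, is_interval (A i) &
      forall i, affine_on (D `&` A i) u /\ affine_on (D `&` A i) v].
Proof.
move=> [I [A [cA iA aA]]] [J [B [cB iB aB]]].
exists (I * J)%type, (fun x => A x.1 `&` B x.2); split=> [t Dt|i|i].
- have [i Ai] := cA _ Dt; have [j Bj] := cB _ Dt.
  by exists (i, j).
- exact: is_intervalI.
- split.
  + by have [k [c h]] := aA i.1; exists k, c => t [Dt [At Bt]]; apply: h.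
  + by have [k [c h]] := aB i.2; exists k, c => t [Dt [At Bt]]; apply: h.
Qed.

Lemma pl_add D u v : pl D u -> pl D v -> pl D (fun t => u t + v t).
Proof.
move=> pu pv; have [I [A [cA iA aA]]] := pl2 pu pv.
exists I, A; split=> // i; have [[k [c h]] [k' [c' h']]] := aA i.
by exists (k + k'), (c + c') => t hDt; rewrite h// h'// intrD; ring.
Qed.

Lemma pl_opp D u : pl D u -> pl D (fun t => - u t).
Proof.
move=> [I [A [cA iA aA]]]; exists I, A; split=> // i.
by have [k [c h]] := aA i; exists (- k), (- c) => t Dt; rewrite h// intrN; ring.
Qed.

(** Half line, line or empty set: this is why the maximum of two affine
    functions is piecewise affine. *)
Lemma is_interval_affine_le (k c k' c' : R) :
  is_interval [set t | k * t + c <= k' * t + c'].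
Proof.
move=> x y /= hx hy z /andP[xz zy].
have [kk'|kk'] := leP k k'.
  have : (k' - k) * x <= (k' - k) * z by rewrite ler_wpM2l// subr_ge0.
  by move: hx; lra.
have : (k - k') * z <= (k - k') * y by rewrite ler_wpM2l// subr_ge0 ltW.
by move: hy; lra.
Qed.

Lemma pl_max D u v : pl D u -> pl D v -> pl D (fun t => Num.max (u t) (v t)).
Proof.
move=> pu pv; have [I [A [cA iA aA]]] := pl2 pu pv.
apply: (pl_glue (J := A)) => // i.
have [[k [c h]] [k' [c' h']]] := aA i.
apply: (@pl_glue _ _ _ (fun b => if b then [set t | k%:~R * t + c <= k'%:~R * t + c']
   else [set t | k'%:~R * t + c' <= k%:~R * t + c])).
- move=> t _; case: (leP (k%:~R * t + c) (k'%:~R * t + c')) => [?|/ltW ?].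
    by exists true.
  by exists false.
- by case; exact: is_interval_affine_le.
- case; apply: affine_on_pl.
    by exists k', c' => t /= [hDt]; rewrite h// h'// => le; rewrite max_r.
  by exists k, c => t /= [hDt]; rewrite h// h'// => le; rewrite max_l.
Qed.

Lemma pl_min D u v : pl D u -> pl D v -> pl D (fun t => Num.min (u t) (v t)).
Proof.
move=> pu pv; apply: pl_ext (pl_opp (pl_max (pl_opp pu) (pl_opp pv))) => t _ /=.
by rewrite -oppr_min opprK.
Qed.

Lemma pl_abs_sub D s : pl D (fun t => `|t - s|).
Proof.
have pa : pl D (fun t => t - s).
  by apply: affine_on_pl; exists 1, (- s) => t _; rewrite mul1r.
apply: pl_ext (pl_max pa (pl_opp pa)) => t _ /=.
by case: leP; case: ger0P => //; lra.
Qed.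

Lemma pl_comp_affine D D' g (m : int) (c : R) :
  (forall t, D t -> D' (m%:~R * t + c)) -> pl D' g ->
  pl D (fun t => g (m%:~R * t + c)).
Proof.
move=> DD' [I [A [cA iA aA]]].
exists I, (fun i => [set t | A i (m%:~R * t + c)]); split => [t /DD'/cA//|i|i].
  move=> x y /= Ax Ay z /andP[xz zy].
  have [m0|m0] := leP 0 (m%:~R : R).
    by apply: (iA i _ _ Ax Ay); rewrite !lerD2r !ler_wpM2l.
  by apply: (iA i _ _ Ay Ax); rewrite !lerD2r !ler_wnM2l// ltW.
have [k [b h]] := aA i.
exists (k * m), (k%:~R * c + b) => t /= [/DD' Dt At].
by rewrite h// intrM; ring.
Qed.

(** One of the finitely many pieces is an unbounded interval.  This gives the
    limits at the points at infinity. *)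
Lemma pl_eventually D g : (forall t, 0 <= t -> D t) -> pl D g ->
  exists (k : int) (c t0 : R), forall t, t0 < t -> g t = k%:~R * t + c.
Proof.
move=> D0 [I [A [cA iA aA]]].
have [[i hi]|nA] := pselect (exists i, forall M : R, exists2 t, A i t & M < t).
  have [k [c h]] := aA i; have [t0 At0 t00] := hi 0.
  exists k, c, t0 => t t0t; apply: h; split; first by apply: D0; lra.
  have [t1 At1 tt1] := hi t; apply: (iA i _ _ At0 At1).
  by rewrite !ltW.
have /choice[M hM] : forall i, exists M : R, forall t, A i t -> t <= M.
  move=> i; apply: contrapT => nM; apply: nA; exists i => M.
  apply: contrapT => nt; apply: nM; exists M => t At; rewrite leNgt.
  by apply/negP => Mt; apply: nt; exists t.
pose m := \big[Num.max/0]_i M i.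
have m0 : 0 <= m by exact: bigmax_ge_id.
have [i Ai] := cA (m + 1) (D0 _ (addr_ge0 m0 ler01)).
have := hM _ _ Ai; have : M i <= m by exact: le_bigmax.
lra.
Qed.

Definition cont_on D g := forall t, D t -> forall eta : R, 0 < eta ->
  exists2 del : R, 0 < del & forall t', D t' -> `|t - t'| < del -> `|g t - g t'| < eta.

Definition lips_on D K g := forall s t, D s -> D t -> `|g s - g t| <= K * `|s - t|.

(** The set of the [x] such that the estimate holds between [s] and [x] contains
    its supremum [c] by continuity.  If [c < t], one of the finitely many
    sets of the cover contains points that tend to [c] from the right, and
    the estimate propagates along it past [c]. *)
Lemma lips_on_union D g (I : finType) (A : I -> set R) K : 0 <= K ->
  is_interval D -> (forall t, D t -> exists i, A i t) -> cont_on D g ->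
  (forall i, lips_on (D `&` A i) K g) -> lips_on D K g.
Proof.
move=> K0 iD cA cg lA.
suff H s t : D s -> D t -> s < t -> `|g s - g t| <= K * `|s - t|.
  move=> s t Ds Dt; case: (ltgtP s t) => [st|ts|->]; first exact: H.
    by rewrite distrC (distrC s); exact: H.
  by rewrite !subrr normr0 mulr0.
move=> Ds Dt st.
have D_ x : s <= x -> x <= t -> D x by move=> ? ?; apply: (iD s t) => //; apply/andP.
pose S := [set x | [/\ s <= x, x <= t & `|g s - g x| <= K * (x - s)]].
have Ss : S s by split=> //; [exact: ltW|rewrite !subrr normr0 mulr0].
have supS : has_sup S by split; [exists s|exists t => x []].
pose c := sup S.
have sc : s <= c by apply: sup_upper_bound.
have ct : c <= t by apply: sup_le_ub; [exists s|move=> x []].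
have Sc : S c.
  split=> //; apply/ler_addgt0Pr => eta eta0.
  have [del del0 hdel] := cg c (D_ _ sc ct) eta eta0.
  have [x Sx cx] := sup_adherent del0 supS.
  have xc : x <= c by apply: sup_upper_bound.
  have [sx xt hx] := Sx.
  have := hdel x (D_ _ sx xt); rewrite ger0_norm ?subr_ge0// => /(_ _)/wrap[].
    by move: cx; rewrite -/c; lra.
  have tri : `|g s - g c| <= `|g s - g x| + `|g c - g x|.
    by rewrite (distrC (g c)) (le_trans _ (ler_normD _ _))// addrA subrK.
  have : K * (x - s) <= K * (c - s) by rewrite ler_wpM2l// lerD2r.
  by move=> h1 /ltW h2; apply: (le_trans tri); apply: lerD => //; apply: le_trans h1.
have [ct'|] := ltP c t; last first.
  move=> tc; have ctE : c = t by apply/eqP; rewrite eq_le ct.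
  by have [_ _] := Sc; rewrite ctE (distrC s) (@ger0_norm _ (t - s))// subr_ge0 ltW.
exfalso.
have [i hi] : exists i, ~ \forall x \near c^'+, ~ A i x.
  apply: contrapT => /forallNP ni.
  have /filter_forall nA i : \forall x \near c^'+, ~ A i x by apply: contrapT; exact: ni.
  have : \forall x \near c^'+, False.
    near=> x; have cx : c < x by near: x; exact: nbhs_right_gt.
    have xt : x < t by near: x; exact: nbhs_right_lt.
    have [|i Ai] := cA x; first by apply: D_; lra.
    have : forall i, ~ A i x by near: x; exact: nA.
    by move/(_ i).
  by move=> /filter_ex[].
have hA del : 0 < del -> exists x, [/\ A i x, c < x, x < c + del & x < t].
  move=> del0; apply: contrapT => nx; apply: hi; near=> x.
  have cx : c < x by near: x; exact: nbhs_right_gt.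
  have xd : x < c + del by near: x; apply: nbhs_right_lt; lra.
  have xt : x < t by near: x; exact: nbhs_right_lt.
  by move=> Aix; apply: nx; exists x.
have [x [Ax cx _ xt]] := hA 1 ltr01.
suff : S x by move=> /(sup_upper_bound supS); rewrite -/c; lra.
have Dx : D x by apply: D_; lra.
have Dc := D_ _ sc ct.
split; [lra|lra|].
have : `|g c - g x| <= K * (x - c).
  apply/ler_addgt0Pr => eta eta0.
  have [del del0 hdel] := cg c Dc eta eta0.
  have [|y [Ay cy ydel yt]] := hA (Num.min del (x - c)).
    by rewrite lt_min del0 subr_gt0.
  move: ydel; rewrite -ltrBlDl lt_min => /andP[yd yx].
  have Dy : D y by apply: D_; lra.
  have h1 := lA i _ _ (conj Dy Ay) (conj Dx Ax).
  have /ltW h2 : `|g c - g y| < eta.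
    by apply: hdel => //; rewrite distrC ger0_norm//; lra.
  have tri : `|g c - g x| <= `|g c - g y| + `|g y - g x|.
    by rewrite (le_trans _ (ler_normD _ _))// addrA subrK.
  apply: (le_trans tri); rewrite addrC; apply: lerD => //.
  apply: (le_trans h1); rewrite ler_wpM2l// distrC ger0_norm; lra.
have [_ _ h1] := Sc => h2.
have tri : `|g s - g x| <= `|g s - g c| + `|g c - g x|.
  by rewrite (le_trans _ (ler_normD _ _))// addrA subrK.
by apply: (le_trans tri); apply: (le_trans (lerD h1 h2)); rewrite -mulrDr ler_wpM2l//; lra.
Unshelve. all: by end_near. Qed.

Lemma pl_lips D g : is_interval D -> cont_on D g -> pl D g ->
  exists2 K, 0 <= K & lips_on D K g.
Proof.
move=> iD cg [I [A [cA iA aA]]].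
have /choice[k hk] : forall i, exists k : int, exists c : R,
  forall t, (D `&` A i) t -> g t = k%:~R * t + c by [].
pose K := \sum_i `|(k i)%:~R : R|.
have K0 : 0 <= K by apply: sumr_ge0.
exists K => //; apply: (lips_on_union K0 iD cA cg) => i s t hs ht.
have [c h] := hk i; rewrite h// h//.
rewrite opprD addrACA subrr addr0 -mulrBr normrM ler_wpM2r//.
by rewrite /K (bigD1 i)//= lerDl sumr_ge0.
Qed.

Lemma pia_pl (l : \bar R) (f : R -> \bar R) g :
  (forall t, (0 <= t%:E <= l)%E -> f t = (g t)%:E) ->
  piecewise_integer_affine l f <-> pl [set t | (0 <= t%:E <= l)%E] g.
Proof.
move=> fg; split=> [[s [cs as_]]|[I [A [cA iA aA]]]].
  exists 'I_(size s), (fun i : 'I_(size s) => [set` nth `]-oo, +oo[ s i]); split=> [t /= lt|i|i].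
  - have [i is_ ti] := cs _ lt.
    have ltis : (index i s < size s)%N by rewrite index_mem.
    by exists (Ordinal ltis) => /=; rewrite nth_index.
  - exact: interval_is_interval.
  - have [|k [c h]] := as_ (nth `]-oo, +oo[ s i); first exact: mem_nth.
    by exists k, c => t [/= lt it]; have := h t lt it; rewrite fg// => -[].
exists [seq Rhull (A i) | i <- enum I]; split=> [t lt|j /mapP[i _ ->]].
  have [i Ai] := cA _ lt; exists (Rhull (A i)); last exact: sub_Rhull.
  by apply: map_f; rewrite mem_enum.
have [k [c h]] := aA i; exists k, c => t lt ti; rewrite fg// h//.
by split=> //; have /is_intervalP -> := iA i.
Qed.
End PiecewiseAffine.

(** * Points and distances of a model *)

Section ModelPoints.
Variables (R : realType) (T : topologicalType) (M : model R T).
Implicit Types (e : edge M) (x y z : T).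

Definition on e (t : R) : bool := (0 <= t%:E <= len e)%E.
Definition pt e (t : R) : T := ept e t%:E.
(** For the model of a curve, this is [point_at_infinity]. *)
Definition infpt x := exists e, len e = +oo%E /\ x = ept e +oo%E.
Definition finpt x := ~ infpt x.

Lemma on_between e s t r : on e s -> on e t -> s <= r <= t -> on e r.
Proof.
move=> /andP[s0 _] /andP[_ t1] /andP[sr rt]; apply/andP; split.
  by apply: le_trans s0 _; rewrite lee_fin.
by apply: le_trans t1; rewrite lee_fin.
Qed.

Lemma on0 e : on e 0.
Proof. by rewrite /on lexx/= ltW// len_gt0. Qed.

Lemma on_ge0 e t : on e t -> 0 <= t.
Proof. by case/andP. Qed.

Lemma on_interval e : is_interval [set t | on e t].
Proof. by move=> s t hs ht r hr; exact: on_between hs ht hr. Qed.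

Lemma pt0 e : pt e 0 = vpt (src e).
Proof. exact: ept_src. Qed.

(** A leaf end at infinity belongs to one edge only, and that edge is not a
    loop; the limit along this edge is therefore the limit at the point. *)
Lemma leaf_incident (v : vertex M) e e1 : leaf_end v -> tgt e = v ->
  (tgt e1 = v -> e1 = e) /\ src e1 <> v.
Proof.
move=> lv ev; have et : e \in [set e0 : edge M | tgt e0 == v]%SET by rewrite inE ev.
have /card_gt0P/= c1 : exists e0, e0 \in [set e0 : edge M | tgt e0 == v]%SET by exists e.
move: lv; rewrite /leaf_end /valence => /eqP lv.
have c0 : #|[set e0 : edge M | src e0 == v]%SET| = 0%N by move/eqP: lv; rewrite -(ltn_predK c1) addnS eqSS addn_eq0 => /andP[/eqP].
have c2 : #|[set e0 : edge M | tgt e0 == v]%SET| = 1%N by move: lv; rewrite c0.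
split=> [e1v|/eqP e1v].
  have /cards1P[a ha] : #|[set e0 : edge M | tgt e0 == v]%SET| == 1%N by rewrite c2.
  move: et; rewrite ha inE => /eqP ->.
  have : e1 \in [set e0 : edge M | tgt e0 == v]%SET by rewrite inE e1v.
  by rewrite ha inE => /eqP.
by move: c0 => /eqP; rewrite cards_eq0 => /eqP/setP/(_ e1); rewrite !inE e1v.
Qed.

Lemma ept_interior e e1 (t s : \bar R) : (0 < t < len e)%E ->
  (0 <= s <= len e1)%E -> ept e1 s = ept e t -> e1 = e /\ s = t.
Proof.
move=> ht /andP[]; rewrite le_eqVlt => /predU1P[<- _|s0].
  by rewrite ept_src => /esym/ept_neq_vpt; case.
rewrite le_eqVlt => /predU1P[->|s1].
  by rewrite ept_tgt => /esym/ept_neq_vpt; case.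
by move=> h; apply: ept_inj h => //; apply/andP.
Qed.

Lemma infpt_tgt e e1 : len e = +oo%E -> len e1 = +oo%E ->
  ept e +oo%E = ept e1 +oo%E -> e = e1.
Proof.
move=> le le1; rewrite -{1}le -{1}le1 !ept_tgt => /vpt_inj E.
by have [+ _] := leaf_incident e (model_pinfty le1) erefl; apply.
Qed.

Lemma pt_finite e t : on e t -> finpt (pt e t).
Proof.
move=> ht [e1 [le1 E]]; move: E; rewrite -le1 ept_tgt => E.
have lf := model_pinfty le1; have [h1 h2] := leaf_incident e lf erefl.
move: ht => /andP[]; rewrite le_eqVlt => /predU1P[t0 _|t0].
  by move: E; rewrite /pt -t0 ept_src => /vpt_inj.
rewrite le_eqVlt => /predU1P[tl|tl]; last first.
  by have := @ept_neq_vpt _ _ _ e t%:E (tgt e1); rewrite t0 tl => /(_ isT).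
move: E; rewrite /pt tl ept_tgt => /vpt_inj /h1 ee1.
by move: le1; rewrite -ee1 -tl.
Qed.

Lemma ept_finite e (s : \bar R) : (0 <= s <= len e)%E -> finpt (ept e s) ->
  exists2 t, on e t & s = t%:E.
Proof.
case: s => [t ht _|/andP[_]|] //; first by exists t.
by rewrite leye_eq => /eqP le [] ; exists e.
Qed.

Notation dist := (model_dist M).

Lemma walk_ge0 x y L : walk M x y L -> (0 <= L)%E.
Proof. by elim=> // *; apply: adde_ge0. Qed.

Lemma dist_le_walk x y L : walk M x y L -> (dist x y <= L)%E.
Proof. by move=> w; apply: ereal_inf_lbound. Qed.

Lemma dist_ge x y a : (forall L, walk M x y L -> (a <= L)%E) -> (a <= dist x y)%E.
Proof. by move=> h; apply: le_ereal_inf_tmp => L /h. Qed.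

Lemma dist_ge0 x y : (0 <= dist x y)%E.
Proof. by apply: dist_ge => L; exact: walk_ge0. Qed.

Lemma dist_refl x : dist x x = 0%E.
Proof. by apply/eqP; rewrite eq_le dist_ge0 andbT dist_le_walk//; exact: walk_nil. Qed.

Lemma dist_ept e (s t : \bar R) : (0 <= s <= len e)%E -> (0 <= t <= len e)%E ->
  (dist (ept e s) (ept e t) <= `|s - t|)%E.
Proof.
move=> hs ht; rewrite -[leRHS]adde0; apply: dist_le_walk.
by apply: walk_cons => //; exact: walk_nil.
Qed.

Lemma walk_cat x y z L L' : walk M x y L -> walk M y z L' -> walk M x z (L + L').
Proof.
elim=> [?|e s t y0 L0 hs ht w IH w']; first by rewrite add0e.
by rewrite -addeA; apply: walk_cons => //; exact: IH.
Qed.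

Lemma walk_rev x y L : walk M x y L -> walk M y x L.
Proof.
elim=> [?|e s t y0 L0 hs ht w IH]; first exact: walk_nil.
rewrite addeC; apply: walk_cat IH _; rewrite -[X in walk _ _ _ X]adde0.
have -> : (`|s - t| = `|t - s|)%E.
  by case: s {hs} => [s||]; case: t {ht w} => [t||]//=; rewrite distrC.
by apply: walk_cons => //; exact: walk_nil.
Qed.

Lemma dist_sym x y : dist x y = dist y x.
Proof.
by apply/eqP; rewrite eq_le; apply/andP; split; apply: dist_ge => L /walk_rev;
  exact: dist_le_walk.
Qed.

Lemma dist_tri x y z : (dist x z <= dist x y + dist y z)%E.
Proof.
have [f1|] := boolP (dist x y \is a fin_num); last first.
  rewrite ge0_fin_numE ?dist_ge0// -leNgt leye_eq => /eqP ->.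
  by rewrite addye ?leey// gt_eqF// (lt_le_trans _ (dist_ge0 _ _)).
have [f2|] := boolP (dist y z \is a fin_num); last first.
  rewrite ge0_fin_numE ?dist_ge0// -leNgt leye_eq => /eqP ->.
  by rewrite addey ?leey// gt_eqF// (lt_le_trans _ (dist_ge0 _ _)).
apply/lee_addgt0Pr => eta eta0.
have e2 : 0 < eta / 2 by rewrite divr_gt0.
have [L wL hL] := lb_ereal_inf_adherent e2 f1.
have [L' wL' hL'] := lb_ereal_inf_adherent e2 f2.
apply: (le_trans (dist_le_walk (walk_cat wL wL'))).
apply: (le_trans (leeD (ltW hL) (ltW hL'))).
by rewrite addeACA -EFinD -splitr.
Qed.

Definition edge_lips K (u : T -> R) := forall e s t, on e s -> on e t ->
  `|u (pt e s) - u (pt e t)| <= K * `|s - t|.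

(** The estimate adds up along the segments.  A segment that reaches a point at
    infinity has infinite length, so that a walk of finite length stays
    among the finite points, where [u] is controlled. *)
Lemma walk_lips K u x y L : 0 <= K -> edge_lips K u -> walk M x y L -> finpt x ->
  L \is a fin_num -> finpt y /\ `|u x - u y| <= K * fine L.
Proof.
move=> K0 uK; elim=> [z fz _|e s t y0 L0 hs ht w IH fs].
  by rewrite subrr normr0 mulr0.
have [s' os Es] := ept_finite hs fs; rewrite {}Es in hs fs *.
case: t ht w IH => [t ht w IH|_ w _|/andP[]//]; last first.
  by rewrite /= addye// gt_eqF// (lt_le_trans _ (walk_ge0 w)).
rewrite -EFinB abse_EFin => fL.
have fL0 : L0 \is a fin_num by move: fL; rewrite fin_numD => /andP[].
have [fy IH'] := IH (pt_finite ht) fL0; split=> //.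
have tri : `|u (pt e s') - u y0| <= `|u (pt e s') - u (pt e t)| + `|u (pt e t) - u y0|.
  by rewrite (le_trans _ (ler_normD _ _))// addrA subrK.
apply: (le_trans tri); rewrite fineD//= mulrDr; apply: lerD => //; exact: uK.
Qed.

Lemma dist_lips_fin K u x y : 0 <= K -> edge_lips K u -> finpt x ->
  dist x y \is a fin_num -> finpt y /\ `|u x - u y| <= K * fine (dist x y).
Proof.
move=> K0 uK fx fd.
have h eta : 0 < eta -> finpt y /\ `|u x - u y| <= K * (fine (dist x y) + eta).
  move=> eta0; have [L wL hL] : exists2 L, walk M x y L & (L < dist x y + eta%:E)%E :=
    lb_ereal_inf_adherent eta0 fd.
  have fL : L \is a fin_num by rewrite ge0_fin_numE ?(walk_ge0 wL)// (lt_trans hL)// -(fineK fd) -EFinD ltry.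
  have [fy h] := walk_lips K0 uK wL fx fL; split=> //.
  apply: (le_trans h); rewrite ler_wpM2l// -lee_fin fineK// EFinD fineK//.
  exact: ltW.
split; first by have [] := h 1 ltr01.
apply/ler_addgt0Pr => eta eta0.
have [_ h1] := h (eta / (K + 1)) (divr_gt0 eta0 (ltr_wpDl K0 ltr01)).
apply: (le_trans h1); rewrite mulrDr lerD2l mulrA ler_pdivrMr ?ltr_wpDl//.
by rewrite mulrDr mulr1 (mulrC eta) lerDl ltW.
Qed.

Lemma dist_infpt x y : infpt x -> y <> x -> dist x y = +oo%E.
Proof.
move=> ix yx; apply/eqP; rewrite -leye_eq; apply: dist_ge => L w.
elim: w ix yx => [z _|e s t y0 L0 hs ht w IH ix yx]; first by [].
case: s hs ix yx => [s hs ix|hs ix yx|/andP[]//]; first by case: (@pt_finite e s).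
rewrite leye_eq; apply/eqP.
have -> : (`| +oo - t | = +oo :> \bar R)%E by case: t {ht w IH}.
by rewrite addye// gt_eqF// (lt_le_trans _ (walk_ge0 w)).
Qed.

(** Junk value 0 when the distance is infinite, which does not happen between
    finite points ([dist_fin]). *)
Definition rdist x y := fine (dist x y).

Lemma has_vertex : exists v : vertex M, True.
Proof. by have /card_gt0P[v _] := ewg_nonempty M; exists v. Qed.

Lemma adjacentP (u v : vertex M) : adjacent u v ->
  exists e, (src e = u /\ tgt e = v) \/ (src e = v /\ tgt e = u).
Proof.
by move=> /existsP[e /orP[]/andP[/eqP ? /eqP ?]]; exists e; [left|right].
Qed.

Lemma len_fin_or e : len e = +oo%E \/ exists2 r, len e = r%:E & 0 < r.
Proof.
have := len_gt0 e; case: (len e) => [r|_|//]; last by left.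
by rewrite lte_fin => r0; right; exists r.
Qed.

Lemma dist_pt e s t : on e s -> on e t -> (dist (pt e s) (pt e t) <= `|s - t|%:E)%E.
Proof. by move=> hs ht; apply: le_trans (dist_ept hs ht) _. Qed.

Lemma dist_edge_fin x e : (exists2 s, on e s & dist x (pt e s) \is a fin_num) ->
  forall t, on e t -> dist x (pt e t) \is a fin_num.
Proof.
move=> [s os fs] t ot; rewrite ge0_fin_numE ?dist_ge0//.
apply: (le_lt_trans (dist_tri _ (pt e s) _)).
rewrite -(fineK fs); apply: (@le_lt_trans _ _ (fine (dist x (pt e s)) + `|s - t|)%:E).
  by rewrite EFinD leeD// dist_pt.
exact: ltry.
Qed.

Lemma fpt_vert z : finpt z -> (exists e t, on e t /\ z = pt e t) \/
    exists v : vertex M, z = vpt v /\ forall w : vertex M, w = v.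
Proof.
move=> fz; have [[v zv]|[e [t [ht E]]]] := @model_cover _ _ M z.
  have [[w wv]|/forallNP h] := pselect (exists w, w <> v); last first.
    by right; exists v; split=> // w; apply: contrapT; exact: h.
  have /connectP[[|w' p]/= pth E] := @ewg_connected _ M v w; first by rewrite E in wv.
  move: pth => /andP[/adjacentP[e [[sv tv]|[sv tv]]] _]; left.
    by exists e, 0; rewrite on0 pt0 sv.
  have [t ot Et] : exists2 t, on e t & len e = t%:E.
    by apply: ept_finite; rewrite ?lexx ?ltW ?len_gt0// ept_tgt tv -zv.
  by exists e, t; split=> //; rewrite /pt -Et ept_tgt tv.
have ht' : (0 <= t <= len e)%E by case/andP: ht => /ltW -> /ltW.
have [t' ot Et] : exists2 t', on e t' & t = t'%:E by apply: ept_finite => //; rewrite -E.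
by left; exists e, t'; split=> //; rewrite E Et.
Qed.

Lemma fpt_pt (e0 : edge M) z : finpt z -> exists e t, on e t /\ z = pt e t.
Proof.
case/fpt_vert => // -[v [-> hv]].
by exists e0, 0; rewrite on0 pt0 (hv (src e0)).
Qed.

(** Connectedness is given in terms of vertices, some of which may be at
    infinity and cannot be reached.  The invariant propagated along a path
    of vertices is therefore that the finite points of all the edges at the
    current vertex are at finite distance of [x]: a vertex at infinity has a
    single edge and inherits it from its neighbour. *)
Lemma dist_fin x y : finpt x -> finpt y -> dist x y \is a fin_num.
Proof.
move=> fx fy.
pose P w := forall e, src e = w \/ tgt e = w -> forall t, on e t -> dist x (pt e t) \is a fin_num.
have step u v : P u -> adjacent u v -> P v.
  move=> Pu /adjacentP[e euv].
  have Pe t : on e t -> dist x (pt e t) \is a fin_num.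
    by apply: Pu; case: euv => -[? ?]; [left|right].
  move=> e1 e1v.
  have [lf|[r lf r0]] := len_fin_or e; last first.
    have [s os Es] : exists2 s, on e s & pt e s = vpt v.
      case: euv => -[hu hv]; last by exists 0; rewrite ?on0// pt0 hu.
      by exists r; rewrite /pt -?lf ?ept_tgt ?hv// /on lf lexx lee_fin ltW.
    have := Pe s os; rewrite Es => fv.
    have [lf1|[r1 lf1 r10]] := len_fin_or e1; last first.
      apply: dist_edge_fin; case: e1v => e1v.
        by exists 0; rewrite ?on0// pt0 e1v.
      by exists r1; rewrite /pt -?lf1 ?ept_tgt ?e1v// /on lf1 lexx lee_fin ltW.
    apply: dist_edge_fin; case: e1v => e1v.
      by exists 0; rewrite ?on0// pt0 e1v.
    exfalso; apply: (pt_finite os); exists e1; split=> //.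
    by rewrite Es -e1v -ept_tgt lf1.
  have lt := model_pinfty lf.
  case: euv => -[hu hv].
    have [h1 h2] := leaf_incident e1 lt erefl.
    by case: e1v => e1v; [case: h2; rewrite e1v|rewrite h1// e1v].
  have [|[r1 lf1 r10]] := len_fin_or e1 => [lf1|].
    apply: dist_edge_fin; case: e1v => e1v.
      by exists 0; rewrite ?on0// pt0 e1v -hu -pt0; apply: Pe; rewrite on0.
    exfalso; apply: (pt_finite (on0 e)); exists e1; split=> //.
    by rewrite pt0 hu -e1v -ept_tgt lf1.
  apply: dist_edge_fin; case: e1v => e1v.
    by exists 0; rewrite ?on0// pt0 e1v -hu -pt0; apply: Pe; rewrite on0.
  exists r1; rewrite /pt -?lf1 ?ept_tgt ?e1v// -?hu -?pt0 ?Pe ?on0//.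
  by rewrite /on lf1 lexx lee_fin ltW.
have conn u v : P u -> P v.
  move=> Pu; have /connectP[p pth ->] := @ewg_connected _ M u v.
  by elim: p u Pu pth => //= w p IH u Pu /andP[uw]; apply: IH; exact: step uw.
have base e t u : x = pt e t -> on e t -> P u.
  move=> E ot; apply: (conn (src e)) => e1 [] he1 s os1.
    suff f0 : dist x (pt e1 0) \is a fin_num.
      by apply: dist_edge_fin os1; exists 0; rewrite ?on0.
    by rewrite pt0 he1 -pt0; apply: dist_edge_fin (on0 e); exists t; rewrite // E dist_refl.
  have [lf1|[r1 lf1 r10]] := len_fin_or e1.
    by have [_] := leaf_incident e (model_pinfty lf1) erefl; rewrite he1.
  suff f0 : dist x (pt e1 r1) \is a fin_num.
    by apply: dist_edge_fin os1; exists r1 => //; rewrite /on lf1 lexx lee_fin ltW.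
  rewrite /pt -lf1 ept_tgt he1 -pt0.
  by apply: dist_edge_fin (on0 e); exists t; rewrite // E dist_refl.
case: (fpt_vert fy) => [[e [t [ot ->]]]|[v [yv hv]]].
  case: (fpt_vert fx) => [[e1 [t1 [ot1 E1]]]|[v [xv hv]]].
    by apply: (base e1 t1 (src e)) => //; left.
  by apply: dist_edge_fin ot; exists 0; rewrite ?on0// pt0 xv (hv (src e)) dist_refl.
case: (fpt_vert fx) => [[e1 [t1 [ot1 E1]]]|[w [xw hw]]].
  have := dist_edge_fin (x := x) (e := e1); rewrite yv -(hv (src e1)) -pt0; apply; last exact: on0.
  by exists t1 => //; rewrite E1 dist_refl.
by rewrite yv xw (hv w) dist_refl.
Qed.
End ModelPoints.

(** * Functions that are Lipschitz and piecewise affine along the edges *)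

Section ModelFunctions.
Variables (R : realType) (T : topologicalType) (M : model R T).
Implicit Types (e : edge M) (x y z : T) (u v : T -> R).
Notation dist := (model_dist M).
Notation d := (rdist M).
Notation fpt := (finpt M).

Lemma rdistE x y : fpt x -> fpt y -> dist x y = (d x y)%:E.
Proof. by move=> fx fy; rewrite fineK// dist_fin. Qed.

Lemma rdist_ge0 x y : 0 <= d x y.
Proof. by apply: fine_ge0; exact: dist_ge0. Qed.

Lemma rdist_sym x y : d x y = d y x.
Proof. by rewrite /rdist dist_sym. Qed.

Lemma rdist_refl x : d x x = 0.
Proof. by rewrite /rdist dist_refl. Qed.

Lemma rdist_tri x y z : fpt x -> fpt y -> fpt z -> d x z <= d x y + d y z.
Proof.
by move=> fx fy fz; rewrite -lee_fin EFinD -!rdistE//; exact: dist_tri.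
Qed.

Lemma rdist_pt e s t : on e s -> on e t -> d (pt e s) (pt e t) <= `|s - t|.
Proof.
move=> os ot; rewrite -lee_fin -rdistE ?dist_pt//; exact: pt_finite.
Qed.

Lemma edge_lips_rdist K u x y : 0 <= K -> edge_lips M K u -> fpt x -> fpt y ->
  `|u x - u y| <= K * d x y.
Proof. by move=> K0 uK fx fy; have [] := dist_lips_fin K0 uK fx (dist_fin fx fy). Qed.

(** Follow the walk as long as it stays on [e]: it ends there, or it leaves [e]
    by one of its two ends. *)
Lemma walk_from_edge x y L : walk M x y L -> forall e t, on e t -> x = pt e t ->
  [\/ exists s, [/\ on e s, y = pt e s & (`|t - s|%:E <= L)%E],
      (t%:E + dist (pt e 0) y <= L)%E |
      exists2 r, len e = r%:E & ((r - t)%:E + dist (pt e r) y <= L)%E].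
Proof.
elim=> [z e t ot ->|e1 s1 t1 y0 L0 hs ht w IH e t ot E].
  by apply: Or31; exists t; rewrite subrr normr0.
have w' := walk_cons hs ht w.
have fs : fpt (ept e1 s1) by rewrite E; exact: pt_finite.
have [s2 os2 Es] := ept_finite hs fs; rewrite {}Es in E w' *.
case: t1 ht w IH w' => [t1 ht w IH w'|_ w _ _|/andP[]//]; last first.
  apply: Or32; rewrite [leRHS](_ : _ = +oo%E) ?leey//.
  by rewrite /= addye// gt_eqF// (lt_le_trans _ (walk_ge0 w)).
have [t0|t0] := leP t 0.
  apply: Or32; have t00 : t = 0 by apply/eqP; rewrite eq_le t0 (on_ge0 ot).
  by rewrite t00 add0e -t00 -E; exact: dist_le_walk w'.
have [tl|tl] := ltP t%:E (len e); last first.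
  have lt : len e = t%:E by apply/eqP; rewrite eq_le tl; case/andP: ot.
  by apply: Or33; exists t => //; rewrite subrr add0e -E; exact: dist_le_walk w'.
have [|ee [st]] := ept_interior _ os2 E; first by apply/andP; rewrite lte_fin.
subst e1 s2.
case: (IH e t1 ht erefl) => [[s [os -> hsL]]|hL|[r lr hL]].
- apply: Or31; exists s; split=> //.
  apply: le_trans (leeD (lexx _) hsL); rewrite -EFinB abse_EFin -EFinD lee_fin.
  by rewrite (le_trans _ (ler_normD _ _))// addrA subrK.
- apply: Or32; apply: le_trans (leeD (lexx _) hL).
  rewrite addeA leeD2r// -EFinB abse_EFin -EFinD lee_fin.
  have := ler_norm (t - t1); lra.
- apply: Or33; exists r => //; apply: le_trans (leeD (lexx _) hL).
  rewrite addeA leeD2r// -EFinB abse_EFin -EFinD lee_fin.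
  have := ler_norm (t1 - t); rewrite distrC; lra.
Qed.

Lemma on_len e r : len e = r%:E -> on e r.
Proof. by move=> lr; rewrite /on lr lexx -lr ltW// len_gt0. Qed.

(** The second term exists for edges of finite length only: no walk of finite
    length goes through a point at infinity. *)
Definition via_ends e y (t : R) : R :=
  if len e is r%:E then Num.min (t + d (pt e 0) y) (r - t + d (pt e r) y)
  else t + d (pt e 0) y.

Lemma rdist_le_via_ends e y t : fpt y -> on e t -> d (pt e t) y <= via_ends e y t.
Proof.
move=> fy ot; have ft := pt_finite ot; have f0 := pt_finite (on0 e).
have l2 : d (pt e t) y <= t + d (pt e 0) y.
  apply: (le_trans (rdist_tri ft f0 fy)); rewrite lerD2r.
  by rewrite (le_trans (rdist_pt ot (on0 e)))// subr0 ger0_norm// (on_ge0 ot).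
rewrite /via_ends; case lr : (len e) => [r||] //; rewrite le_min l2/=.
have or := on_len lr.
apply: (le_trans (rdist_tri ft (pt_finite or) fy)); rewrite lerD2r.
rewrite (le_trans (rdist_pt ot or))// distrC ger0_norm// subr_ge0.
by case/andP: ot => _; rewrite lr lee_fin.
Qed.

(** The formula that makes the distance to [y] piecewise affine along [e].  The
    second case is the direct way inside [e] to an interior point [y]; the
    direct way to an end of [e] is a special case of [via_ends]. *)
Lemma rdist_edge e y t : fpt y -> on e t ->
  d (pt e t) y = via_ends e y t \/
  exists s, [/\ (0 < s%:E < len e)%E, y = pt e s & d (pt e t) y = `|t - s|].
Proof.
move=> fy ot; have ft := pt_finite ot; have f0 := pt_finite (on0 e).
have [[s [hs ys]]|ns] := pselect (exists s : R, (0 < s%:E < len e)%E /\ y = pt e s).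
  have os : on e s by case/andP: hs => /ltW ? /ltW ?; apply/andP.
  suff : Num.min `|t - s| (via_ends e y t) <= d (pt e t) y.
    rewrite ge_min => /orP[h|h]; [right; exists s; split=> //|left].
      by apply/eqP; rewrite eq_le h ys rdist_pt.
    by apply/eqP; rewrite eq_le h rdist_le_via_ends.
  rewrite -lee_fin -rdistE//; apply: dist_ge => L /walk_from_edge/(_ e t ot erefl).
  case=> [[s' [os' E hL]]|hL|[r lr hL]]; apply: le_trans hL.
  + rewrite lee_fin ge_min; have [_ [->]] := ept_interior hs os' (esym (etrans (esym ys) E)).
    by rewrite lexx.
  + by rewrite rdistE// -EFinD lee_fin ge_min /via_ends; case: (len e) => [r||]; rewrite ?ge_min lexx ?orbT.
  + rewrite rdistE//; last exact/pt_finite/on_len.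
    by rewrite -EFinD lee_fin ge_min /via_ends lr ge_min lexx !orbT.
left; apply/eqP; rewrite eq_le rdist_le_via_ends//=.
rewrite -lee_fin -rdistE//; apply: dist_ge => L /walk_from_edge/(_ e t ot erefl).
case=> [[s' [os' E hL]]|hL|[r lr hL]]; apply: le_trans hL.
- have [s0|s0] := leP s' 0.
    have s00 : s' = 0 by apply/eqP; rewrite eq_le s0 (on_ge0 os').
    rewrite s00 subr0 ger0_norm ?(on_ge0 ot)// lee_fin /via_ends E s00 rdist_refl addr0.
    by case: (len e) => [r||]//; rewrite ge_min lexx.
  have [sl|sl] := ltP s'%:E (len e).
    by exfalso; apply: ns; exists s'; rewrite lte_fin s0.
  have ls : len e = s'%:E by apply/eqP; rewrite eq_le sl; case/andP: os'.
  rewrite /via_ends ls lee_fin E rdist_refl addr0 ge_min.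
  by move: ot; rewrite /on ls lee_fin => /andP[_]; rewrite lee_fin => ts; rewrite distrC ger0_norm ?subr_ge0// lexx orbT.
- by rewrite rdistE// -EFinD lee_fin /via_ends; case: (len e) => [r||]; rewrite ?ge_min lexx ?orbT.
- rewrite rdistE//; last exact/pt_finite/on_len.
  by rewrite -EFinD lee_fin /via_ends lr ge_min lexx !orbT.
Qed.

(** What remains of a rational function other than -oo at the finite points.
    The Lipschitz condition plays the part of continuity there, and it is
    what the final estimate uses. *)
Definition Ratfin u := (exists2 K, 0 <= K & edge_lips M K u) /\
  forall e, pl [set t | on e t] (fun t => u (pt e t)).

Lemma pl_via_ends e y D : pl D (via_ends e y).
Proof.
have h0 : pl D (fun t => t + d (pt e 0) y).
  by apply: affine_on_pl; exists 1, (d (pt e 0) y) => t _; rewrite mul1r.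
case lr : (len e) => [r||]; last 2 first.
- by apply: pl_ext h0 => t _; rewrite /via_ends lr.
- by apply: pl_ext h0 => t _; rewrite /via_ends lr.
have h1 : pl D (fun t => r - t + d (pt e r) y).
  by apply: affine_on_pl; exists (-1), (r + d (pt e r) y) => t _; rewrite mulN1r; ring.
by apply: pl_ext (pl_min h0 h1) => t _; rewrite /via_ends lr.
Qed.

Lemma edge_lips_dist y : fpt y -> edge_lips M 1 (fun x => d x y).
Proof.
move=> fy e s t os ot; rewrite mul1r ler_norml.
have h1 := rdist_tri (pt_finite os) (pt_finite ot) fy.
have h2 := rdist_tri (pt_finite ot) (pt_finite os) fy.
have h3 := rdist_pt os ot; rewrite (rdist_sym (pt e t) (pt e s)) in h2.
by apply/andP; split; lra.
Qed.

(** These functions of [Gam'] are the source of all the pullbacks used in the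
    proof. *)
Lemma Ratfin_dist y : fpt y -> Ratfin (fun x => d x y).
Proof.
move=> fy; split; first by exists 1 => //; exact: edge_lips_dist.
move=> e; have pv := @pl_via_ends e y [set t | on e t].
have [[s [hs ys]]|ns] := pselect (exists s : R, (0 < s%:E < len e)%E /\ y = pt e s).
  apply: pl_ext (pl_min pv (pl_abs_sub _ s)) => t /= ot.
  have os : on e s by case/andP: hs => /ltW ? /ltW ?; apply/andP.
  have h1 := rdist_le_via_ends fy ot; have h2 := rdist_pt ot os; rewrite -ys in h2.
  have [E|[s' [hs' ys' E]]] := rdist_edge fy ot; rewrite E in h1 h2 *.
    by apply/min_idPl.
  have [_ [ss]] := ept_interior hs (ltac:(by case/andP: hs' => /ltW ? /ltW ?; apply/andP) : (0 <= s'%:E <= len e)%E) (esym (etrans (esym ys) ys')).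
  by rewrite ss in h1 *; apply/min_idPr.
apply: pl_ext pv => t /= ot.
by have [->//|[s [hs ys _]]] := rdist_edge fy ot; case: ns; exists s.
Qed.

Lemma Ratfin_cst c : Ratfin (fun=> c).
Proof.
split; first by exists 0 => // e s t _ _; rewrite subrr normr0 mul0r.
by move=> e; apply: affine_on_pl; exists 0, c => t _; rewrite mul0r add0r.
Qed.

Lemma Ratfin_add u v : Ratfin u -> Ratfin v -> Ratfin (fun x => u x + v x).
Proof.
move=> [[K K0 hK] pu] [[K' K'0 hK'] pv]; split.
  exists (K + K'); first exact: addr_ge0.
  move=> e s t os ot; rewrite opprD addrACA mulrDl.
  by rewrite (le_trans (ler_normD _ _))// lerD ?hK ?hK'.
by move=> e; exact: pl_add.
Qed.

Lemma Ratfin_opp u : Ratfin u -> Ratfin (fun x => - u x).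
Proof.
move=> [[K K0 hK] pu]; split.
  by exists K => // e s t os ot; rewrite -opprD normrN hK.
by move=> e; exact: pl_opp.
Qed.

Lemma Ratfin_max u v : Ratfin u -> Ratfin v -> Ratfin (fun x => Num.max (u x) (v x)).
Proof.
move=> [[K K0 hK] pu] [[K' K'0 hK'] pv]; split.
  exists (K + K'); first exact: addr_ge0.
  move=> e s t os ot; have := hK e s t os ot; have := hK' e s t os ot.
  have := mulr_ge0 K0 (normr_ge0 (s - t)); have := mulr_ge0 K'0 (normr_ge0 (s - t)).
  rewrite mulrDl; set a := K * _; set b := K' * _ => a0 b0.
  rewrite !ler_norml => /andP[? ?] /andP[? ?].
  by case: (leP (u (pt e s))) => ?; case: (leP (u (pt e t))) => ?; lra.
by move=> e; exact: pl_max.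
Qed.

Lemma Ratfin_mulrn u (n : nat) : Ratfin u -> Ratfin (fun x => n%:R * u x).
Proof.
move=> ru; elim: n => [|n IH].
  by rewrite (_ : (fun _ => _) = (fun=> 0)); [exact: Ratfin_cst|apply/funext => x; rewrite mul0r].
rewrite (_ : (fun _ => _) = (fun x => u x + n%:R * u x)); first exact: Ratfin_add.
by apply/funext => x; rewrite -natr1; ring.
Qed.

(** The value 0 is taken outside the open edge; if [h] vanishes at the ends, no
    case distinction on loops is needed. *)
Definition edge_fun e (h : R -> R) x : R :=
  xget 0 [set z | exists t, [/\ (0 < t%:E < len e)%E, x = pt e t & z = h t]].

Lemma edge_fun_in e h t : h 0 = 0 -> (forall r, len e = r%:E -> h r = 0) ->
  on e t -> edge_fun e h (pt e t) = h t.
Proof.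
move=> h0 hr ot; rewrite /edge_fun; case: xgetP => [z _ [s [hs E ->]]|].
  by have [_ [->]] := ept_interior hs ot E.
move=> n; have [t0|t0] := leP t 0.
  have -> : t = 0 by apply/eqP; rewrite eq_le t0 (on_ge0 ot).
  by rewrite h0.
have [sl|sl] := ltP t%:E (len e).
  by case: (n (h t)); exists t; split=> //; rewrite lte_fin t0.
by rewrite hr//; apply/eqP; rewrite eq_le sl; case/andP: ot.
Qed.

Lemma edge_fun_out e h e1 t : e1 != e -> on e1 t -> edge_fun e h (pt e1 t) = 0.
Proof.
move=> ne ot; rewrite /edge_fun; case: xgetP => // z _ [s [hs E _]].
by have [ee _] := ept_interior hs ot E; rewrite ee eqxx in ne.
Qed.

(** The distance to the ends of an edge of length [l]; an infinite edge has only
    its source as finite end. *)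
Definition tent (l : \bar R) (t : R) : R := if l is r%:E then Num.min t (r - t) else t.

Lemma tent_edge e t : on e t -> edge_fun e (tent (len e)) (pt e t) = tent (len e) t.
Proof.
apply: edge_fun_in => [|r lr]; last by rewrite /tent lr subrr min_r// (on_ge0 (on_len lr)).
rewrite /tent; case lr: (len e) => [r||]//.
by rewrite subr0 min_l// (on_ge0 (on_len lr)).
Qed.

Lemma tent_lips l s t : `|tent l s - tent l t| <= `|s - t|.
Proof.
rewrite /tent; case: l => [r||]//.
have := ler_norm (s - t); have := ler_norm (t - s); rewrite distrC => ? ?.
by rewrite ler_norml; case: (leP s (r - s)) => ?; case: (leP t (r - t)) => ?; lra.
Qed.

(** As a consequence the tent bounds distances from below, which shows that half
    edges are geodesic ([rdist_half]). *)
Lemma edge_lips_tent e : edge_lips M 1 (edge_fun e (tent (len e))).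
Proof.
move=> e1 s t os ot; rewrite mul1r; have [ee|ne] := eqVneq e1 e.
  by subst e1; rewrite !tent_edge// tent_lips.
by rewrite !edge_fun_out// subrr normr0.
Qed.

Lemma Ratfin_tent e : Ratfin (edge_fun e (tent (len e))).
Proof.
split; first by exists 1 => //; exact: edge_lips_tent.
move=> e1; have [ee|ne] := eqVneq e1 e; last first.
  apply: pl_ext (affine_on_pl (g := fun=> 0) _) => [t /= ot|]; first by rewrite edge_fun_out.
  by exists 0, 0 => t _; rewrite mul0r addr0.
subst e1; apply: (@pl_ext _ _ (tent (len e))) => [t ot|]; first by rewrite tent_edge.
have h0 D : pl D (fun t : R => t).
  by apply: affine_on_pl; exists 1, 0 => t _; rewrite mul1r addr0.
rewrite /tent; case: (len e) => [r||]//; apply: pl_min => //.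
by apply: affine_on_pl; exists (-1), r => t _; rewrite mulN1r addrC.
Qed.

Definition in_cell (a : R) (b : \bar R) (t : R) : bool := (a <= t) && (t%:E <= b)%E.

(** The interval [[a, b]] does not cross the middle of [[0, l]]. *)
Definition half (l : \bar R) (a : R) (b : \bar R) : Prop :=
  if l is r%:E then (b <= (r / 2)%:E)%E \/ r / 2 <= a else True.

Lemma tent_half l a b : (b <= l)%E -> half l a b -> exists (sg : bool) (c : R),
  forall t, 0 <= t -> in_cell a b t -> tent l t = (-1) ^+ sg * t + c.
Proof.
rewrite /half /tent /in_cell; case: l => [r||]; last 2 first.
- by move=> _ _; exists false, 0 => t _ _; rewrite mul1r addr0.
- by move=> _ _; exists false, 0 => t _ _; rewrite mul1r addr0.
move=> bl [hb|ha].
  exists false, 0 => t _ /andP[_ tb]; rewrite mul1r addr0 min_l//.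
  by have := le_trans tb hb; rewrite lee_fin; lra.
exists true, r => t _ /andP[at_ tb]; rewrite expr1 mulN1r addrC min_r//.
lra.
Qed.

(** The tent is 1-Lipschitz and, on a half edge, it varies as much as the
    position does. *)
Lemma rdist_half e a b s t : (b <= len e)%E -> half (len e) a b -> 0 <= a ->
  in_cell a b s -> in_cell a b t -> d (pt e s) (pt e t) = `|s - t|.
Proof.
move=> bl hab a0 hs ht.
have on_ r : in_cell a b r -> on e r.
  by move=> /andP[ar rb]; apply/andP; rewrite lee_fin (le_trans a0)// (le_trans rb).
have os := on_ s hs; have ot := on_ t ht.
apply/eqP; rewrite eq_le rdist_pt//=.
have := edge_lips_rdist ler01 (@edge_lips_tent e) (pt_finite os) (pt_finite ot).
rewrite mul1r !tent_edge//; apply: le_trans.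
have [sg [c h]] := tent_half bl hab.
rewrite !h ?(on_ge0 os) ?(on_ge0 ot)// opprD addrACA subrr addr0 -mulrBr.
by rewrite normrM normrX normrN1 expr1n mul1r.
Qed.

(** An infinite cell has [a] as only finite end, which is then counted twice. *)
Definition cell_end e (a : R) (b : \bar R) : T := if b is r%:E then pt e r else pt e a.

(** The distance to the cell.  Testing whether [x] is interior to the cell
    avoids the ambiguity of positions at vertices: at the ends the minimum
    is 0 anyway. *)
Definition cell_dist e (a : R) (b : \bar R) x : R :=
  if `[< exists2 t, (a%:E < t%:E < b)%E & x = pt e t >] then 0
  else Num.min (d x (pt e a)) (d x (cell_end e a b)).

Section CellDist.
Variables (e : edge M) (a : R) (b : \bar R).
Hypotheses (a0 : 0 <= a) (ab : (a%:E < b)%E) (bl : (b <= len e)%E).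
Local Notation G := (cell_dist e a b).

Lemma cell_on t : in_cell a b t -> on e t.
Proof. by move=> /andP[ar rb]; apply/andP; rewrite lee_fin (le_trans a0)// (le_trans rb). Qed.

Lemma on_cell_a : on e a.
Proof. by apply: cell_on; rewrite /in_cell lexx ltW. Qed.

Lemma cell_end_in : exists2 s, in_cell a b s & cell_end e a b = pt e s.
Proof.
move: ab; rewrite /in_cell /cell_end; case: b => [r h|_|//]; last by exists a; rewrite // lexx leey.
by exists r; rewrite // lexx andbT -lee_fin ltW.
Qed.

Lemma cell_dist_in t : in_cell a b t -> G (pt e t) = 0.
Proof.
move=> ct; rewrite /cell_dist; case: asboolP => // n.
have [ta|ta] := leP t a.
  have -> : t = a by apply/eqP; rewrite eq_le ta; case/andP: ct.
  by rewrite rdist_refl min_l// rdist_ge0.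
have [tb|tb] := ltP t%:E b.
  by case: n; exists t; rewrite // lte_fin ta.
have -> : b = t%:E by apply/eqP; rewrite eq_le tb; case/andP: ct.
by rewrite rdist_refl min_r// rdist_ge0.
Qed.

Lemma cell_dist_out e1 t : on e1 t -> (e1 = e -> t <= a \/ (b <= t%:E)%E) ->
  G (pt e1 t) = Num.min (d (pt e1 t) (pt e a)) (d (pt e1 t) (cell_end e a b)).
Proof.
move=> ot h; rewrite /cell_dist; case: asboolP => // -[s /andP[as_ sb] E].
have [|/h{}h [ts]] := @ept_interior _ _ _ e e1 s%:E t%:E _ ot E.
  by rewrite (lt_le_trans sb)// (le_lt_trans _ as_).
by move: as_ sb h; rewrite -ts => as_ sb [|]; rewrite ?leNgt ?as_ ?sb// -lte_fin as_.
Qed.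

Lemma cell_dist_ge0 x : 0 <= G x.
Proof. by rewrite /cell_dist; case: asboolP => // _; rewrite le_min !rdist_ge0. Qed.

Lemma cell_dist_near x : fpt x -> exists2 s, in_cell a b s & d x (pt e s) <= G x.
Proof.
move=> fx; rewrite /cell_dist; case: asboolP => [[s /andP[as_ sb] ->]|_].
  by exists s; rewrite ?rdist_refl// /in_cell -lee_fin !ltW.
have [s cs ->] := cell_end_in.
have [_|_] := leP (d x (pt e a)) _; last by exists s.
by exists a; rewrite // /in_cell lexx ltW.
Qed.

(** On [e], the minimum of the two distances is replaced by 0 between the ends
    of the cell; the result is continuous there because one of the two
    distances vanishes at each end. *)
Lemma Ratfin_cell_dist : Ratfin G.
Proof.
have [s cs Es] := cell_end_in.
have fa := pt_finite on_cell_a; have fs := pt_finite (cell_on cs).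
have la := edge_lips_dist fa; have ls := edge_lips_dist fs.
have pmin e1 : pl [set t | on e1 t]
    (fun t => Num.min (d (pt e1 t) (pt e a)) (d (pt e1 t) (cell_end e a b))).
  by rewrite Es; apply: pl_min; [have [_] := Ratfin_dist fa|have [_] := Ratfin_dist fs]; apply.
have lmin e1 s1 t1 : on e1 s1 -> on e1 t1 ->
    `|Num.min (d (pt e1 s1) (pt e a)) (d (pt e1 s1) (pt e s)) -
      Num.min (d (pt e1 t1) (pt e a)) (d (pt e1 t1) (pt e s))| <= `|s1 - t1|.
  move=> os1 ot1; have := la e1 s1 t1 os1 ot1; have := ls e1 s1 t1 os1 ot1.
  rewrite !mul1r !ler_norml => /andP[? ?] /andP[? ?].
  case: (leP (d (pt e1 s1) (pt e a))) => ?; case: (leP (d (pt e1 t1) (pt e a))) => ?;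
    by apply/andP; split; lra.
split.
  exists 1 => // e1 s1 t1 os1 ot1; rewrite mul1r.
  have [ee|ne] := eqVneq e1 e; last first.
    by rewrite !cell_dist_out ?Es ?lmin// => E; rewrite E eqxx in ne.
  subst e1.
  have key s2 t2 : on e s2 -> on e t2 -> a < s2 /\ (s2%:E < b)%E ->
      `|G (pt e s2) - G (pt e t2)| <= `|s2 - t2|.
    move=> os2 ot2 [as2 s2b].
    have c2 : in_cell a b s2 by rewrite /in_cell !ltW.
    rewrite (cell_dist_in c2) sub0r normrN ger0_norm ?cell_dist_ge0//.
    have [ta|ta] := leP t2 a.
      rewrite cell_dist_out//; last by left.
      apply: (@le_trans _ _ (d (pt e t2) (pt e a))); first by rewrite ge_min lexx.
      apply: (le_trans (rdist_pt ot2 on_cell_a)); rewrite distrC !ger0_norm; lra.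
    have [tb|tb] := leP b t2%:E; last first.
      by rewrite cell_dist_in// /in_cell !ltW.
    rewrite cell_dist_out//; last by right.
    have [b' bE] : exists b' : R, b = b'%:E.
      by move: tb s2b; case: (b) => [r||]//; exists r.
    apply: (@le_trans _ _ (d (pt e t2) (cell_end e a b))).
      by rewrite ge_min lexx orbT.
    move: tb s2b; rewrite bE lee_fin lte_fin /cell_end => tb s2b.
    have ob : on e b'.
      by apply: cell_on; rewrite bE /in_cell lexx (le_trans (ltW as2) (ltW s2b)).
    by apply: (le_trans (rdist_pt ot2 ob)); rewrite (distrC s2) !ger0_norm; lra.
  have [/andP c1|n1] := boolP ((a < s1) && (s1%:E < b)%E); first exact: key.
  have [/andP c2|n2] := boolP ((a < t1) && (t1%:E < b)%E).
    by rewrite distrC (distrC s1); exact: key.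
  rewrite !cell_dist_out ?Es ?lmin// => _.
    by move: n2; rewrite negb_and -!leNgt => /orP[]; [left|right].
  by move: n1; rewrite negb_and -!leNgt => /orP[]; [left|right].
move=> e1; have [ee|ne] := eqVneq e1 e; last first.
  by apply: pl_ext (pmin e1) => t ot; rewrite cell_dist_out// => E; rewrite E eqxx in ne.
subst e1.
pose J (i : option bool) : set R := match i with
  | None => [set t | t <= a]
  | Some true => [set t | in_cell a b t]
  | Some false => [set t | (b <= t%:E)%E] end.
apply: (pl_glue (J := J)) => [t _|[[]|]|[[]|]].
- have [ta|ta] := leP t a; first by exists None.
  have [tb|tb] := leP t%:E b; first by exists (Some true); rewrite /J/= /in_cell tb ltW.
  by exists (Some false); exact: ltW.
- move=> x y /= /andP[ax _] /andP[_ yb] z /andP[xz zy].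
  by rewrite /in_cell (le_trans ax)//=; apply: le_trans yb; rewrite lee_fin.
- by move=> x y /= bx _ z /andP[xz _]; apply: le_trans bx _; rewrite lee_fin.
- by move=> x y /= _ ya z /andP[_ zy]; exact: le_trans ya.
- apply: pl_ext (affine_on_pl (g := fun=> 0) _) => [t [/= ot ct]|]; first by rewrite cell_dist_in.
  by exists 0, 0 => t _; rewrite mul0r addr0.
- apply: pl_ext (pl_sub _ (pmin e)) => [t [/= ot ta]|t []//].
  by rewrite cell_dist_out//; right.
- apply: pl_ext (pl_sub _ (pmin e)) => [t [/= ot ta]|t []//].
  by rewrite cell_dist_out//; left.
Qed.
End CellDist.
End ModelFunctions.

(** * Topology of a model and the semiring of rational functions *)

Section ModelTopology.
Variables (R : realType) (T : topologicalType) (M : model R T).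
Implicit Types (e : edge M) (x y z : T) (u v : T -> R).

(** The quotient topology, read in the parameters of the edges; the second
    clause is the neighbourhood filter of +oo. *)
Lemma open_edgeP (A : set T) : open A <-> forall e,
  (forall t, on e t -> A (pt e t) -> exists2 del, 0 < del &
     forall s, on e s -> `|t - s| < del -> A (pt e s)) /\
  (len e = +oo%E -> A (ept e +oo%E) -> exists m : R, forall s, on e s -> m < s -> A (pt e s)).
Proof.
split=> [/(@model_open _ _ M) oA e|H].
  have /open_subspaceP[V oV VA] := oA e.
  have VP w : (0 <= w <= len e)%E -> V w <-> A (ept e w).
    by move=> hw; have := congr1 (fun X => X w) VA; rewrite /setI/= in_itv/= => E;
      split=> h; [have : (V w /\ (0 <= w <= len e)%E) by []|have : (A (ept e w) /\ (0 <= w <= len e)%E) by []]; rewrite (E, esym E) => -[].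
  split=> [t ot /(VP t%:E ot) Vt|le].
    have /nbhs_ballP[del /= del0 hdel] : nbhs t (fun r => V r%:E) := open_nbhs_nbhs (conj oV Vt).
    by exists del => // s os ts; apply/(VP s%:E os); exact: hdel.
  move=> /(VP +oo%E); rewrite le lexx leey => /(_ isT) Vy.
  have [m [_ hm]] : nbhs +oo%E V := open_nbhs_nbhs (conj oV Vy).
  by exists m => s os ms; apply/(VP s%:E os)/hm; rewrite lte_fin.
apply/(@model_open _ _ M) => e; apply/open_subspaceP.
pose W : set (\bar R) := [set w | (0 <= w <= len e)%E -> A (ept e w)].
exists (W°); first exact: open_interior.
apply/seteqP; split=> w [] /=; rewrite in_itv/=.
  by move=> /interior_subset Ww hw; split=> //; exact: Ww.
move=> Aw hw; split=> //; have [h1 h2] := H e.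
case: w Aw hw => [t At ot|Ay /andP[_]|_ /andP[]//].
  have [del del0 hdel] := h1 t ot At.
  suff : nbhs t (fun r => W r%:E) by [].
  by apply/nbhs_ballP; exists del => //= s ts os; exact: (hdel s os ts).
rewrite leye_eq => /eqP le; have [m hm] := h2 le Ay.
exists m; split; first exact: num_real.
by case=> [s|_ _|//]//; rewrite lte_fin => ms os; exact: (hm s os ms).
Qed.

Lemma open_edge_part e (al be : \bar R) : (0 <= al)%E -> (be <= len e)%E ->
  open (ept e @` [set w | (al < w < be)%E]).
Proof.
move=> al0 bel.
have int w : (al < w < be)%E -> (0 < w < len e)%E.
  by move=> /andP[aw wb]; rewrite (le_lt_trans al0 aw)/= (lt_le_trans wb).
apply/open_edgeP => e1; split=> [t ot [w hw E]|le [w hw E]]; last first.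
  have [|ee yw] := ept_interior (int w hw) _ (esym E); first by rewrite le leey lexx.
  by move: hw => /andP[_]; rewrite -yw ltNge leey.
have [ee tw] := ept_interior (int w hw) ot (esym E); subst e1 w.
have : nbhs t [set s : R | (al < s%:E < be)%E].
  have oE : open [set w | (al < w < be)%E].
    rewrite (_ : [set _ | _] = [set w | (al < w)%E] `&` [set w | (w < be)%E]).
      by apply: openI; [exact: open_ereal_gt_ereal|exact: open_ereal_lt_ereal].
    by apply/seteqP; split=> w /= => [/andP[]|[-> ->]].
  exact: (@open_nbhs_nbhs _ t%:E _ (conj oE hw)).
move=> /nbhs_ballP[del /= del0 hdel]; exists del => // s os ts.
by exists s%:E => //; exact: hdel.
Qed.

(** A point at infinity is a leaf end, so that the tails of its edge are
    neighbourhoods of it. *)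
Lemma open_tail e m : len e = +oo%E -> 0 <= m ->
  open (ept e @` [set w | (m%:E < w)%E]).
Proof.
move=> le m0; apply/open_edgeP => e1; split=> [t ot [w /= mw E]|le1 [w /= mw E]].
  have [wy|wy] := eqVneq w +oo%E.
    by case: (@pt_finite _ _ _ e1 t ot); exists e; rewrite -E wy.
  have hw : (0 < w < len e)%E.
    by rewrite le (le_lt_trans _ mw) ?lee_fin//= lt_neqAle wy leey.
  have [ee tw] := ept_interior hw ot (esym E); subst e1 w.
  exists (t - m); first by rewrite subr_gt0 -lte_fin.
  move=> s os ts; exists s%:E => //=; rewrite lte_fin.
  have := ler_norm (t - s); lra.
have wy : w = +oo%E.
  apply: contrapT => /eqP wy; have hw : (0 < w < len e)%E.
    by rewrite le (le_lt_trans _ mw) ?lee_fin//= lt_neqAle wy leey.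
  have [|ee yw] := ept_interior hw _ (esym E); first by rewrite le1 leey lexx.
  by rewrite -yw in wy.
subst w; have ee := infpt_tgt le le1 E; subst e1.
by exists m => s os ms; exists s%:E => //=; rewrite lte_fin.
Qed.

Lemma cvg_at_infpt (Y : topologicalType) (f : T -> Y) e : continuous f -> len e = +oo%E ->
  f (pt e t) @[t --> +oo] --> f (ept e +oo%E).
Proof.
move=> cf le B; rewrite nbhsE => -[V [oO Ofx] OB].
have /open_edgeP/(_ e)[_ /(_ le Ofx)[m hm]] : open (f @^-1` V).
  by move/continuousP : cf; apply.
exists (Num.max m 0); split; first exact: num_real.
move=> t; rewrite gt_max => /andP[mt t0]; apply: OB; apply: hm => //.
by rewrite /on le leey andbT lee_fin ltW.
Qed.

(** A point at infinity is not isolated, so that limits there are unique. *)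
Lemma infpt_proper e : len e = +oo%E -> ProperFilter ((ept e +oo%E)^').
Proof.
move=> le; apply: Build_ProperFilter_ex => B.
rewrite /dnbhs /within/= nbhsE => -[V [oO Ox] OB].
have /open_edgeP/(_ e)[_ /(_ le Ox)[m hm]] := oO.
have os : on e (Num.max m 0 + 1).
  by rewrite /on le leey andbT lee_fin addr_ge0// le_max lexx orbT.
exists (pt e (Num.max m 0 + 1)); apply: OB.
  by apply: hm => //; rewrite (le_lt_trans (_ : _ <= Num.max m 0)) ?ltrDl// le_max lexx.
by apply/eqP => E; apply: (pt_finite os); exists e.
Qed.

(** Limits along the edge determine the limits over punctured neighbourhoods,
    which are those that [rat_mul] takes. *)
Lemma cvg_dnbhs_infpt (Y : topologicalType) (f : T -> Y) e (L : Y) : len e = +oo%E ->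
  f (pt e t) @[t --> +oo] --> L -> f y @[y --> (ept e +oo%E)^'] --> L.
Proof.
move=> le fL B /fL[m [_ hm]].
rewrite /nbhs/= /dnbhs /within/=.
have m0 : 0 <= Num.max m 0 by rewrite le_max lexx orbT.
have : nbhs (ept e +oo%E) (ept e @` [set w | ((Num.max m 0)%:E < w)%E]).
  apply: open_nbhs_nbhs; split; first exact: open_tail.
  by exists +oo%E => //=; exact: ltry.
apply: filterS => y [w /= mw <-] /eqP ne.
case: w mw ne => [t mt _|//|//].
by apply: hm; move: mt; rewrite lte_fin gt_max => /andP[].
Qed.

Lemma continuous_eq_finite (Y : topologicalType) (f g : T -> Y) : hausdorff_space Y ->
  continuous f -> continuous g -> (forall x, finpt M x -> f x = g x) -> f = g.
Proof.
move=> hY cf cg fg; apply/funext => x.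
have [[e [le ->]]|/fg//] := pselect (infpt M x).
have cf1 := cvg_at_infpt cf le; have cg1 := cvg_at_infpt cg le.
apply: (cvg_unique hY cf1).
apply: cvg_trans cg1; apply: near_eq_cvg.
exists 0; split; first exact: num_real.
by move=> t t0; apply/esym/fg; apply: pt_finite; rewrite /on le leey andbT lee_fin ltW.
Qed.

(** The values of [u] at the points at infinity are ignored. *)
Definition ext u x : \bar R :=
  if pselect (exists e, len e = +oo%E /\ x = ept e +oo%E) is left h
  then lim ((u (pt (projT1 (cid h)) t))%:E @[t --> +oo]) else (u x)%:E.

Lemma ext_finite u x : finpt M x -> ext u x = (u x)%:E.
Proof. by rewrite /ext => fx; case: pselect. Qed.

Lemma ext_infinite u e : len e = +oo%E ->
  ext u (ept e +oo%E) = lim ((u (pt e t))%:E @[t --> +oo]).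
Proof.
move=> le; rewrite /ext; case: pselect => [h|[]]; last by exists e.
case: cid => /= e1 [le1 E].
by rewrite (infpt_tgt le1 le (esym E)).
Qed.

Lemma cvg_affine (k : int) (c : R) :
  exists L : \bar R, (fun t : R => (k%:~R * t + c)%:E) @ +oo --> L.
Proof.
have [k0|k0|->] := ltgtP k 0; last first.
- exists c%:E; under eq_fun do rewrite mul0r add0r; exact: cvg_cst.
- exists +oo%E => B [m [_ hm]]; exists ((m - c) / k%:~R); split; first exact: num_real.
  move=> t; rewrite ltr_pdivrMr ?ltr0z// => h; apply: hm.
  by rewrite lte_fin; lra.
- exists -oo%E => B [m [_ hm]]; exists ((m - c) / k%:~R); split; first exact: num_real.
  move=> t; rewrite ltr_ndivrMr ?ltrz0// => h; apply: hm.
  by rewrite lte_fin; lra.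
Qed.

Lemma cvg_ext_infinite u e : Ratfin M u -> len e = +oo%E ->
  (u (pt e t))%:E @[t --> +oo] --> ext u (ept e +oo%E).
Proof.
move=> [_ pu] le; rewrite ext_infinite//.
have [|k [c [t0 h]]] := @pl_eventually _ _ (fun t => u (pt e t)) _ (pu e).
  by move=> t t0 /=; rewrite /on le leey andbT lee_fin.
have [L hL] := cvg_affine k c.
suff cL : (u (pt e t))%:E @[t --> +oo] --> L by rewrite (cvg_lim (@ereal_hausdorff R) cL).
apply: cvg_trans hL; apply: near_eq_cvg.
by exists t0; split; [exact: num_real|move=> t /h ->].
Qed.

Lemma ext_continuous u : Ratfin M u -> continuous (ext u).
Proof.
move=> ru; apply/continuousP => U oU; apply/open_edgeP => e; split=> [t ot|le] /= Ux.
  rewrite ext_finite in Ux; last exact: pt_finite.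
  have /nbhs_ballP[del /= del0 hdel] : nbhs (u (pt e t)) (fun r => U r%:E).
    exact: (open_nbhs_nbhs (conj oU Ux)).
  have [[K K0 uK] _] := ru.
  exists (del / (K + 1)); first by rewrite divr_gt0// ltr_wpDl.
  move=> s os; rewrite ltr_pdivlMr ?ltr_wpDl// => ts.
  rewrite ext_finite; last exact: pt_finite.
  apply: hdel; rewrite /ball/=; apply: le_lt_trans (uK e t s ot os) _.
  apply: le_lt_trans ts; rewrite mulrC ler_wpM2l//; lra.
have /(_ U)[|m [_ hm]] := cvg_ext_infinite ru le; first exact: open_nbhs_nbhs.
by exists m => s os ms; rewrite ext_finite; [exact: hm|exact: pt_finite].
Qed.
End ModelTopology.

Section MaxContinuous.
Variables (R : realType) (T : topologicalType).

Lemma ereal_between (a b : \bar R) : (a < b)%E -> exists2 r : R, (a < r%:E)%E & (r%:E < b)%E.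
Proof.
case: a b => [a||] [b||]//; rewrite ?lte_fin.
- by move=> ab; exists ((a + b) / 2); rewrite lte_fin; lra.
- by exists (a + 1); rewrite ?ltry// lte_fin; lra.
- by exists (b - 1); rewrite ?ltNyr// lte_fin; lra.
- by exists 0; rewrite ?ltry ?ltNyr.
Qed.

Lemma near_lte (f g : T -> \bar R) x : {for x, continuous f} -> {for x, continuous g} ->
  (f x < g x)%E -> \forall y \near x, (f y < g y)%E.
Proof.
move=> cf cg /ereal_between[r fr rg].
have /cf nf : nbhs (f x) [set w | (w < r%:E)%E].
  by apply: open_nbhs_nbhs; split => //; exact: open_ereal_lt_ereal.
have /cg ng : nbhs (g x) [set w | (r%:E < w)%E].
  by apply: open_nbhs_nbhs; split => //; exact: open_ereal_gt_ereal.
by near=> y; apply: (@lt_trans _ _ r%:E); [near: y; exact: nf|near: y; exact: ng].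
Unshelve. all: by end_near. Qed.

Lemma continuous_maxe (f g : T -> \bar R) : continuous f -> continuous g ->
  continuous (fun x => maxe (f x) (g x)).
Proof.
move=> cf cg x; have [fg|gf|E] := ltgtP (f x) (g x).
- rewrite /continuous_at/= max_r ?ltW//; apply: cvg_trans (cg x); apply: near_eq_cvg.
  by apply: filterS (near_lte (cf x) (cg x) fg) => y /ltW h; rewrite max_r.
- rewrite /continuous_at/= max_l ?ltW//; apply: cvg_trans (cf x); apply: near_eq_cvg.
  by apply: filterS (near_lte (cg x) (cf x) gf) => y /ltW h; rewrite max_l.
- move=> B; rewrite /= E maxxx => hB.
  have h1 : nbhs x (g @^-1` B) by exact: cg.
  have h2 : nbhs x (f @^-1` B) by apply: cf; rewrite E.
  apply: filterS (filterI h1 h2) => y [gB fB] /=.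
  by rewrite /maxe; case: ifP.
Qed.
End MaxContinuous.

Section RatCurve.
Variables (R : realType) (Gam : tropical_curve R).
Notation M := (curve_model Gam).
Notation fpt := (finpt M).
Implicit Types (f g : Gam -> \bar R) (u v : Gam -> R).

Lemma rational_ext u : Ratfin M u -> rational (ext M u).
Proof.
move=> ru; right; split; first exact: ext_continuous.
  move=> e; apply/(@pia_pl _ _ _ (fun t => u (pt e t))).
    by move=> t ot; rewrite ext_finite//; exact: pt_finite.
  by have [_] := ru; apply.
by move=> x fx; rewrite ext_finite.
Qed.

Lemma Ratfin_fine f : rational f -> f <> cst -oo%E ->
  Ratfin M (fine \o f) /\ forall x, fpt x -> f x = (fine (f x))%:E.
Proof.
move=> [//|[cf pf ff]] _.
have fE x : fpt x -> f x = (fine (f x))%:E by move=> fx; rewrite fineK//; exact: ff.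
split=> //.
have pl_f (e : edge M) : pl [set t | on e t] (fun t => (fine \o f) (pt e t)).
  have H : forall t, (0 <= t%:E <= len e)%E -> f (pt e t) = ((fine \o f) (pt e t))%:E.
    by move=> t ot; exact: (fE _ (pt_finite (ot : on e t))).
  exact: (pia_pl H).1 (pf e).
have lf (e : edge M) : exists2 K, 0 <= K & lips_on [set t | on e t] K (fun t => (fine \o f) (pt e t)).
  apply: pl_lips => //; first exact: on_interval.
  move=> t /= ot eta eta0.
  have ft := fE _ (pt_finite ot).
  have oU : open (EFin @` ball (fine (f (pt e t))) eta).
    rewrite (_ : _ @` _ = [set w | ((fine (f (pt e t)) - eta)%:E < w)%E] `&` [set w | (w < (fine (f (pt e t)) + eta)%:E)%E]).
      by apply: openI; [exact: open_ereal_gt_ereal|exact: open_ereal_lt_ereal].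
    apply/seteqP; split=> [w [r rb <-] /=|[r||]/= []//].
      by move: rb; rewrite /ball/= ltr_norml !lte_fin => /andP[? ?]; split; lra.
    rewrite !lte_fin => h1 h2; exists r => //.
    by rewrite /ball/= ltr_norml; apply/andP; split; lra.
  have oA : open (f @^-1` (EFin @` ball (fine (f (pt e t))) eta)).
    exact: ((continuousP _).1 cf _ oU).
  have /open_edgeP/(_ e)[hA _] := oA.
  have [|del del0 hdel] := hA t ot.
    by exists (fine (f (pt e t))); [exact: ballxx|exact: esym].
  by exists del => // s os /(hdel s os) /= [r rb <-].
split=> //.
have /choice[K hK] : forall e : edge M, exists K, 0 <= K /\ lips_on [set t | on e t] K (fun t => (fine \o f) (pt e t)).
  by move=> e; have [K K0 hK] := lf e; exists K.
exists (\sum_e K e); first by apply: sumr_ge0 => e _; have [] := hK e.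
move=> e s t os ot; have [_ h] := hK e; apply: (le_trans (h s t os ot)).
rewrite ler_wpM2r// (bigD1 e)//= lerDl sumr_ge0// => e1 _.
by have [] := hK e1.
Qed.

Lemma rational_continuous f : rational f -> continuous f.
Proof. by case=> [->|[]//]; exact: cst_continuous. Qed.

Lemma rat_eq_finite f g : rational f -> rational g ->
  (forall x, fpt x -> f x = g x) -> f = g.
Proof.
move=> /rational_continuous cf /rational_continuous cg.
exact: (continuous_eq_finite (@ereal_hausdorff R) cf cg).
Qed.

(** To identify a product, including its limits at infinity, it is enough to
    know a rational function with the right values at the finite points. *)
Lemma rat_mulE f g h : rational h -> (forall x, fpt x -> h x = (f x + g x)%E) ->
  rat_mul f g = h.
Proof.
move=> rh hE; apply/funext => x; rewrite /rat_mul; case: asboolP => [/hE//|].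
move=> /contrapT[e [le ->]]; have := cvg_at_infpt (rational_continuous rh) le => ch.
have PF := infpt_proper le.
apply: (cvg_lim (@ereal_hausdorff R)).
apply: (@cvg_dnbhs_infpt _ _ M _ (fun y => (f y + g y)%E)) => //.
apply: cvg_trans ch; apply: near_eq_cvg.
exists 0; split; first exact: num_real.
move=> t t0; rewrite hE//; apply: pt_finite.
by rewrite /on le leey andbT lee_fin ltW.
Qed.

Lemma rational_cst (c : R) : rational (cst c%:E : Gam -> \bar R).
Proof.
have := rational_ext (Ratfin_cst M c); congr rational.
apply: (continuous_eq_finite (M := M) (@ereal_hausdorff R)).
- exact: ext_continuous (Ratfin_cst _ _).
- exact: cst_continuous.
- by move=> x fx; rewrite ext_finite.
Qed.

Lemma rational_add f g : rational f -> rational g -> rational (rat_add f g).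
Proof.
move=> rf rg.
have [->|nf] := pselect (f = cst -oo%E).
  by rewrite (_ : rat_add _ _ = g)//; apply/funext => x; rewrite /rat_add maxNye.
have [->|ng] := pselect (g = cst -oo%E).
  by rewrite (_ : rat_add _ _ = f)//; apply/funext => x; rewrite /rat_add maxeNy.
have [ru fE] := Ratfin_fine rf nf; have [rv gE] := Ratfin_fine rg ng.
have rm := Ratfin_max ru rv.
rewrite (_ : rat_add f g = ext M (fun x => Num.max ((fine \o f) x) ((fine \o g) x))).
  exact: rational_ext.
apply: (continuous_eq_finite (M := M) (@ereal_hausdorff R)).
- by apply: continuous_maxe; exact: rational_continuous.
- exact: ext_continuous.
- by move=> x fx; rewrite ext_finite// /rat_add fE// gE// EFin_max.
Qed.

Lemma rational_mul f g : rational f -> rational g -> rational (rat_mul f g).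
Proof.
move=> rf rg; have rN : rational (cst -oo%E : Gam -> \bar R) by left.
have [->|nf] := pselect (f = cst -oo%E); first by rewrite (@rat_mulE _ _ (cst -oo%E)).
have [->|ng] := pselect (g = cst -oo%E).
  by rewrite (@rat_mulE _ _ (cst -oo%E))// => x _; rewrite addeNy.
have [ru fE] := Ratfin_fine rf nf; have [rv gE] := Ratfin_fine rg ng.
have ra := Ratfin_add ru rv.
rewrite (rat_mulE (rational_ext ra)); first exact: rational_ext.
by move=> x fx; rewrite ext_finite// fE// gE.
Qed.

Lemma subsemiring_Rat : subsemiring (@Rat R Gam).
Proof.
split=> //; [by left|exact: rational_cst|exact: rational_add|exact: rational_mul].
Qed.
End RatCurve.

(** * Subdivision of edges *)

Section Subdivision.
Variable R : realType.

Definition in_open (a : R) (b : \bar R) (t : R) : bool := (a < t) && (t%:E < b)%E.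

Definition subinterval (l : \bar R) (c : R * \bar R) : Prop :=
  [/\ 0 <= c.1, (c.1%:E < c.2)%E & (c.2 <= l)%E].

Lemma in_cellP a b t : (a%:E < b)%E -> in_cell a b t -> [\/ t = a, b = t%:E | in_open a b t].
Proof.
rewrite /in_cell /in_open => ab /andP[].
rewrite le_eqVlt => /predU1P[->|at_]; first by constructor 1.
rewrite le_eqVlt => /predU1P[->|tb]; first by constructor 2.
by constructor 3; rewrite at_.
Qed.

Lemma in_open_cell a b t : in_open a b t -> in_cell a b t.
Proof. by move=> /andP[/ltW ? /ltW ?]; apply/andP. Qed.

(** Start from [[0, l]] and cut at the elements of [B] one after the other. *)
Lemma subdivision (l : \bar R) (B : seq R) : (0 < l)%E -> exists cs : seq (R * \bar R),
  [/\ forall c, c \in cs -> subinterval l c,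
      forall t, (0 <= t%:E <= l)%E -> exists2 c, c \in cs & in_cell c.1 c.2 t &
      forall r c, r \in B -> c \in cs -> ~ in_open c.1 c.2 r].
Proof.
move=> l0; elim: B => [|r B [cs [h1 h2 h3]]].
  exists [:: (0, l)]; split=> [c|t /andP[]|//].
    by rewrite inE => /eqP ->.
  by rewrite lee_fin => t0 tl; exists (0, l); rewrite ?inE// /in_cell/= t0.
pose cut (c : R * \bar R) := if in_open c.1 c.2 r then [:: (c.1, r%:E); (r, c.2)] else [:: c].
exists (flatten [seq cut c | c <- cs]); split=> [c /flatten_mapP[c0 c0s]|t ht|r' c r's /flatten_mapP[c0 c0s]].
- have [a0 ab bl] := h1 _ c0s; rewrite /cut; case: ifP => [/andP[ar rb]|_]; last by rewrite inE => /eqP ->.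
  rewrite !inE => /orP[]/eqP ->; split=> //=; first by rewrite (le_trans (ltW rb)).
  exact: le_trans a0 (ltW ar).
- have [c cs_ /andP[ct tc]] := h2 _ ht.
  have [cr|cr] := boolP (in_open c.1 c.2 r); last first.
    by exists c; [apply/flatten_mapP; exists c; rewrite // /cut (negbTE cr) inE|apply/andP].
  have [tr|rt] := leP t r.
    exists (c.1, r%:E); last by rewrite /in_cell ct lee_fin.
    by apply/flatten_mapP; exists c; rewrite // /cut cr !inE eqxx.
  exists (r, c.2); last by rewrite /in_cell tc/= ltW.
  by apply/flatten_mapP; exists c; rewrite // /cut cr !inE eqxx orbT.
- rewrite /cut; case: ifP => [/andP[ar rb]|/negP nr]; last first.
    by rewrite inE => /eqP ->; move: r's; rewrite inE => /predU1P[->//|/h3]; apply.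
  have main : forall q, q \in B -> in_open c0.1 c0.2 q -> False by move=> q qB; apply: (h3 q c0).
  rewrite !inE => /orP[]/eqP -> /andP[/= h h'].
    move: r's; rewrite inE => /predU1P[E|/main]; first by rewrite E ltxx in h'.
    by apply; rewrite /in_open h/= (lt_trans h').
  move: r's; rewrite inE => /predU1P[E|/main]; first by rewrite E ltxx in h.
  by apply; rewrite /in_open h' andbT (lt_trans ar).
Qed.

Lemma in_open_half l (c : R * \bar R) : (0 < l)%E ->
  (forall r, l = r%:E -> ~ in_open c.1 c.2 (r / 2)) -> half l c.1 c.2.
Proof.
move=> l0 h; rewrite /half; case: l l0 h => [r||]// r0 /(_ r erefl)/negP.
by rewrite negb_and -!leNgt => /orP[]; [right|left].
Qed.

Lemma interval_one_piece (I : finType) (O_ : I -> set R) (a : R) (b : \bar R) :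
  (a%:E < b)%E -> (forall i, open (O_ i `&` [set t | in_open a b t])) ->
  (forall t, in_open a b t -> exists i, O_ i t) ->
  (forall i j t, O_ i t -> O_ j t -> i = j) ->
  exists i, forall t, in_open a b t -> O_ i t.
Proof.
move=> ab oO cO dO; have [t0 at0 t0b] := ereal_between ab.
have t0ab : in_open a b t0 by rewrite /in_open -lte_fin at0.
have [i it0] := cO _ t0ab; exists i.
pose J := [set t | in_open a b t].
have cJ : connected J.
  apply/connected_intervalP => x y /= /andP[ax _] /andP[_ yb] z /andP[xz zy].
  by apply/andP; split; [exact: lt_le_trans ax xz|exact: le_lt_trans yb].
have E : O_ i `&` J = J.
  apply: cJ; first by exists t0.
  - by exists (O_ i `&` J) => //; rewrite setICA setIid.
  - exists (~` \bigcup_(j in [set j | j != i]) (O_ j `&` J)).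
      apply: open_closedC; apply: bigcup_open => j _; exact: oO.
    apply/seteqP; split=> t [].
      by move=> it Jt; split=> // -[j /= /eqP ji [jt _]]; apply: ji; exact: dO jt it.
    move=> Jt /= n; split=> //; have [j jt] := cO _ Jt.
    have [<-//|ji] := eqVneq j i.
    by case: n; exists j.
by move=> t Jt; have : J t by []; rewrite -E => -[].
Qed.

(** Injectivity is local to [A] because the map from positions to points may
    identify the two ends of an edge. *)
Lemma finite_inj_preimage (U : Type) (A : set R) (f : R -> U) (Z : set U) :
  (forall s t, A s -> A t -> f s = f t -> s = t) -> finite_set Z ->
  finite_set (A `&` f @^-1` Z).
Proof.
move=> fi fZ.
pose g t : U + R := if `[< A t >] then inl (f t) else inr t.
have gE : A `&` f @^-1` Z = g @^-1` (inl @` Z).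
  apply/seteqP; split=> t /=.
    by move=> [At Zt]; exists (f t) => //; rewrite /g asboolT.
  by move=> [z Zz]; rewrite /g; case: asboolP => // At [zE]; rewrite -zE.
rewrite gE; apply: finite_preimage; last exact: finite_image.
move=> s t; rewrite !inE /= => -[z Zz +] [z' Zz' +].
by rewrite /g; case: asboolP => // As _; case: asboolP => // At _ [/fi]; apply.
Qed.

(** The images of two distinct points [s0] and [t0] determine the image of any
    other point, by its distances to them. *)
Lemma dilation_affine (J : set R) (tau : R -> R) (g : nat) : (exists s t, [/\ J s, J t & s < t]) ->
  (forall s t, J s -> J t -> `|tau s - tau t| = g%:R * `|s - t|) ->
  exists (k : int) (c : R), forall t, J t -> tau t = k%:~R * t + c.
Proof.
move=> [s0 [t0 [Js0 Jt0 st0]]] h.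
have sq s t : J s -> J t -> (tau s - tau t) ^+ 2 = (g%:R * (s - t)) ^+ 2.
  by move=> Js Jt; rewrite -real_normK ?num_real// h// exprMn real_normK ?num_real// -exprMn.
have [g0|g0] := eqVneq g 0%N.
  exists 0, (tau s0) => t Jt; have := h _ _ Jt Js0.
  by rewrite g0 !mul0r => /normr0_eq0/subr0_eq; rewrite add0r.
set L := g%:R * (t0 - s0).
have L0 : L != 0 by rewrite mulf_neq0 ?pnatr_eq0// subr_eq0 gt_eqF.
(* the squared distances to the images of s0 and t0 determine tau t *)
have key t : J t -> (tau t - tau s0) * (tau t0 - tau s0) = g%:R * (t - s0) * L.
  move=> Jt; have h1 := sq _ _ Jt Js0; have h2 := sq _ _ Jt Jt0; have h3 := sq _ _ Jt0 Js0.
  apply: (mulfI (_ : 2%:R != 0 :> R)); first by rewrite pnatr_eq0.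
  have -> : 2%:R * ((tau t - tau s0) * (tau t0 - tau s0)) =
    (tau t - tau s0) ^+ 2 + (tau t0 - tau s0) ^+ 2 - (tau t - tau t0) ^+ 2 by ring.
  by rewrite h1 h2 h3 /L; ring.
have /eqP := sq _ _ Jt0 Js0; rewrite -/L eqf_sqr => /orP[]/eqP E.
  exists g%:Z, (tau s0 - g%:R * s0) => t Jt; have := key t Jt.
  by rewrite E => /(mulIf L0) h1; rewrite -pmulrn; lra.
exists (- g%:Z), (tau s0 + g%:R * s0) => t Jt; have := key t Jt.
by rewrite E mulrN -mulNr => /(mulIf L0) h1; rewrite intrN -pmulrn; lra.
Qed.

Lemma norm_small (x C : R) : 0 <= C -> (forall eta, 0 < eta -> eta <= 1 -> `|x| <= C * eta) -> x = 0.
Proof.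
move=> C0 h; apply/eqP; rewrite -normr_le0; apply/ler_addgt0Pr => eta eta0.
have p : 0 < Num.min 1 (eta / (C + 1)) by rewrite lt_min ltr01 divr_gt0// ltr_wpDl.
have := h _ p; rewrite ge_min lexx => /(_ isT)/le_trans; apply.
rewrite add0r; apply: (@le_trans _ _ (C * (eta / (C + 1)))).
  by rewrite ler_wpM2l// ge_min lexx orbT.
by rewrite mulrA ler_pdivrMr ?ltr_wpDl// mulrC ler_wpM2l ?ltW// ltrDl.
Qed.
End Subdivision.

Section PathTopology.
Variables (R : realType) (T : topologicalType) (M : model R T) (e : edge M).

Lemma open_path (V : set T) (a : R) (b : \bar R) : 0 <= a -> (b <= len e)%E ->
  open V -> open ([set t | V (pt e t)] `&` [set t | in_open a b t]).
Proof.
move=> a0 bl oV.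
have io : open [set t | in_open a b t].
  rewrite (_ : [set _ | _] = [set t | a < t] `&` [set t | (t%:E < b)%E]).
    by apply: openI; [exact: open_gt|exact: open_ereal_lt].
  by apply/seteqP; split=> t => [/andP[]|[? ?]] //; apply/andP.
have on_ t : in_open a b t -> on e t.
  move=> /andP[at_ tb]; apply/andP; split; last by rewrite (le_trans (ltW tb)).
  by rewrite lee_fin (le_trans a0) ?ltW.
rewrite openE => t [/= Vt tab].
have /open_edgeP/(_ e)[h _] := oV; have [del del0 hdel] := h t (on_ t tab) Vt.
have : nbhs t ([set t | in_open a b t] `&` ball t del).
  by apply: filterI; [exact: open_nbhs_nbhs|exact: nbhsx_ballx].
by apply: filterS => s [sab ts]; split=> //; apply: hdel => //; exact: on_.
Qed.
End PathTopology.

(** * Cells on which the morphism is a dilation *)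

Section HalfEdges.
Variables (R : realType) (T : topologicalType) (M : model R T).

Definition mid (l : \bar R) : \bar R := if l is r%:E then (r / 2)%:E else +oo%E.
Definition half_lo (l : \bar R) (h : bool) : \bar R := if h then mid l else 0%E.
Definition half_hi (l : \bar R) (h : bool) : \bar R := if h then l else mid l.

(** An edge of infinite length has its whole interior as first half, and an
    empty second half. *)
Definition half_edge (i : edge M * bool) : set T :=
  ept i.1 @` [set w | (half_lo (len i.1) i.2 < w < half_hi (len i.1) i.2)%E].

Lemma half_lo_ge0 l h : (0 < l)%E -> (0 <= half_lo l h)%E.
Proof.
case: h => //=; case: l => [r||]// /ltW; rewrite /mid /= ?leey// !lee_fin; lra.
Qed.

Lemma half_hi_le l h : (0 < l)%E -> (half_hi l h <= l)%E.
Proof.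
case: h => //=; case: l => [r||]//; rewrite lte_fin /mid lee_fin; lra.
Qed.

Lemma half_edge_open i : open (half_edge i).
Proof. by apply: open_edge_part; [apply: half_lo_ge0|apply: half_hi_le]; exact: len_gt0. Qed.

Lemma half_edge_disjoint i j x : half_edge i x -> half_edge j x -> i = j.
Proof.
case: i => e h; case: j => e' h' [w /= hw E] [w' /= hw' E'].
have int (e0 : edge M) h0 w0 : (half_lo (len e0) h0 < w0 < half_hi (len e0) h0)%E ->
    (0 < w0 < len e0)%E.
  move=> /andP[aw wb]; have l0 := len_gt0 e0.
  by rewrite (le_lt_trans (half_lo_ge0 h0 l0) aw) (lt_le_trans wb (half_hi_le h0 l0)).
have [ee ww] := ept_inj (int _ _ _ hw) (int _ _ _ hw') (etrans E (esym E')).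
subst e' w'; congr pair.
by case: h h' hw hw' {E E'} => -[]//= /andP[h1 h2] /andP[h3 h4];
  [move: (lt_trans h1 h4)|move: (lt_trans h3 h2)]; rewrite ltxx.
Qed.

(** For an infinite edge, [fine] gives the position 0, hence a vertex. *)
Definition half_points : set T :=
  range (@vpt R T M) `|` range (fun e : edge M => pt e (fine (len e) / 2)).

Lemma half_points_finite : finite_set half_points.
Proof. by rewrite finite_setU; split; apply: finite_image; exact: finite_finset. Qed.

Lemma half_edge_cover x : ~ half_points x -> exists i, half_edge i x.
Proof.
move=> nx; have [[v xv]|[e [w [hw E]]]] := @model_cover _ _ M x.
  by case: nx; left; exists v.
have [wm|mw|wm] := ltgtP w (mid (len e)).
- by exists (e, false), w => //=; rewrite wm andbT; case/andP: hw.
- by exists (e, true), w => //=; rewrite mw; case/andP: hw.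
- case: nx; right; exists e => //; rewrite E wm /pt /mid.
  by move: hw; rewrite wm /mid; case: (len e) => [r|/andP[]|/andP[]].
Qed.

Lemma half_edge_coord i x : half_edge i x -> finpt M x ->
  exists t, [/\ on i.1 t, x = pt i.1 t & (half_lo (len i.1) i.2 < t%:E < half_hi (len i.1) i.2)%E].
Proof.
move=> [w hw <-] fx; move: (hw) => /= /andP[aw wb]; have l0 := len_gt0 i.1.
have hw' : (0 <= w <= len i.1)%E.
  by rewrite (le_trans (half_lo_ge0 i.2 l0) (ltW aw)) (le_trans (ltW wb) (half_hi_le i.2 l0)).
have [t ot wt] := ept_finite hw' fx; exists t; split=> //; rewrite /pt -?wt//.
Qed.

Lemma rdist_half_edge (e : edge M) h s t : (half_lo (len e) h < s%:E < half_hi (len e) h)%E ->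
  (half_lo (len e) h < t%:E < half_hi (len e) h)%E -> rdist M (pt e s) (pt e t) = `|s - t|.
Proof.
have l0 := len_gt0 e; case: h => /= /andP[h1 h2] /andP[h3 h4].
  move: h1 h2 h3 h4 l0; rewrite /mid; case lr: (len e) => [r||]//; rewrite !lte_fin => h1 h2 h3 h4 l0.
  apply: (@rdist_half _ _ _ e (r / 2) (len e)).
  - by [].
  - by rewrite /half lr; right.
  - by lra.
  - by rewrite /in_cell lr lee_fin !ltW.
  - by rewrite /in_cell lr lee_fin !ltW.
apply: (@rdist_half _ _ _ e 0 (mid (len e))) => //.
- exact: (half_hi_le false l0).
- by rewrite /half /mid; case: (len e) => // r; left.
- by rewrite /in_cell -lee_fin !ltW.
- by rewrite /in_cell -lee_fin !ltW.
Qed.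
End HalfEdges.

Lemma nonsingleton_edge (R : realType) (Gam : tropical_curve R) :
  ~ singleton_curve Gam -> exists e : edge (curve_model Gam), True.
Proof.
move=> ns; apply: contrapT => ne; apply: ns.
have [v _] := has_vertex (curve_model Gam); exists (vpt v) => y.
have [[w ->]|[e _]] := @model_cover _ _ (curve_model Gam) y; last by case: ne; exists e.
have /connectP[[|w' p]/= pth ->//] := @ewg_connected _ (curve_model Gam) v w.
by move: pth => /andP[/adjacentP[e _] _]; case: ne; exists e.
Qed.

Section Dilations.
Variables (R : realType) (Gam Gam' : tropical_curve R) (phi : Gam -> Gam').
Hypothesis cphi : continuous phi.
Variables (M : model R Gam) (deg : edge M -> nat).
Hypothesis isM : is_model M.
Hypothesis hdeg : forall e : edge M, (0 < deg e)%N /\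
  forall x y, edge_set e x -> edge_set e y ->
    curve_dist (phi x) (phi y) = ((deg e)%:R%:E * curve_dist x y)%E.
Notation N := (curve_model Gam).
Notation N' := (curve_model Gam').
Notation dist := (model_dist N).
Notation dist' := (model_dist N').
Notation fpt := (finpt N).
Notation d := (rdist N).
Notation d' := (rdist N').
Implicit Types (e : edge N) (x y z : Gam).

(* the successor makes K positive even if M has no edge *)
Let degmax : nat := (\sum_e deg e).+1.
Let K : R := degmax%:R.

Lemma degmax_ge (e : edge M) : (deg e)%:R <= K.
Proof.
rewrite ler_nat /degmax; apply: leqW; rewrite (bigD1 e)//=; exact: leq_addr.
Qed.

Lemma K_gt0 : 0 < K.
Proof. by rewrite ltr0n. Qed.

(** A segment of a walk in [M] runs inside one edge of [M], where [phi] is a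
    dilation by at most [K]. *)
Lemma phi_walk x y L : walk M x y L -> (dist' (phi x) (phi y) <= K%:E * L)%E.
Proof.
elim=> [z|e s t y0 L0 hs ht w IH]; first by rewrite dist_refl mule0.
apply: (le_trans (dist_tri N' _ (phi (ept e t)) _)).
rewrite ge0_muleDr ?(walk_ge0 w)// leeD//.
have es u : (0 <= u <= len e)%E -> edge_set e (ept e u).
  by move=> hu; exists u => //=; rewrite in_itv.
have [_ /(_ _ _ (es s hs) (es t ht))] := hdeg e; rewrite /curve_dist => ->.
apply: (@le_trans _ _ (K%:E * model_dist N (ept e s) (ept e t))%E).
  by rewrite lee_wpmul2r ?lee_fin ?degmax_ge// dist_ge0.
rewrite lee_wpmul2l ?lee_fin ?ler0n//.
by have := isM (ept e s) (ept e t); rewrite /curve_dist => <-; exact: dist_ept.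
Qed.

Lemma phi_lips x y : fpt x -> fpt y -> (dist' (phi x) (phi y) <= (K * d x y)%:E)%E.
Proof.
move=> fx fy; apply/lee_addgt0Pr => eta eta0.
have E : model_dist M x y = (d x y)%:E.
  by rewrite -rdistE//; have := isM x y; rewrite /curve_dist.
have fM : model_dist M x y \is a fin_num by rewrite E.
have e0 : 0 < eta / K by rewrite divr_gt0// K_gt0.
have [L wL hL] : exists2 L, walk M x y L & (L < model_dist M x y + (eta / K)%:E)%E :=
  lb_ereal_inf_adherent e0 fM.
apply: (le_trans (phi_walk wL)); rewrite E -EFinD in hL.
apply: (@le_trans _ _ (K%:E * (d x y + eta / K)%:E)%E).
  by rewrite lee_wpmul2l ?lee_fin ?ler0n// ltW.
by rewrite -EFinM -EFinD lee_fin mulrDr mulrCA divff ?gt_eqF ?K_gt0// mulr1.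
Qed.

Definition image_dist x y : R := d' (phi x) (phi y).

Lemma phi_dist_fin x y : fpt x -> fpt y -> dist' (phi x) (phi y) = (image_dist x y)%:E.
Proof.
move=> fx fy; rewrite /image_dist /rdist fineK// ge0_fin_numE ?dist_ge0//.
exact: le_lt_trans (phi_lips fx fy) (ltry _).
Qed.

Lemma image_dist_le x y : fpt x -> fpt y -> image_dist x y <= K * d x y.
Proof. by move=> fx fy; rewrite -lee_fin -phi_dist_fin// phi_lips. Qed.

Lemma image_dist_tri x y z : fpt x -> fpt y -> fpt z -> image_dist x z <= image_dist x y + image_dist y z.
Proof.
by move=> fx fy fz; rewrite -lee_fin EFinD -!phi_dist_fin//; exact: dist_tri.
Qed.

Lemma image_dist_sym x y : image_dist x y = image_dist y x.
Proof. exact: rdist_sym. Qed.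

Lemma image_dist_edge (e1 : edge M) x y : edge_set e1 x -> edge_set e1 y -> fpt x -> fpt y ->
  image_dist x y = (deg e1)%:R * d x y.
Proof.
move=> ex ey fx fy; have [_ /(_ _ _ ex ey)] := hdeg e1; rewrite /curve_dist.
by rewrite phi_dist_fin// rdistE// -EFinM => -[].
Qed.

Definition dilation e (c : R * \bar R) (g : nat) : Prop := (0 < g)%N /\
  forall s t, in_cell c.1 c.2 s -> in_cell c.1 c.2 t ->
    image_dist (pt e s) (pt e t) = g%:R * `|s - t|.

Lemma on_sub e c t : subinterval (len e) c -> in_cell c.1 c.2 t -> on e t.
Proof. by move=> [a0 ab bl]; exact: cell_on. Qed.

(** The interior of the cell is connected and avoids the vertices of [M], so
    that it lies inside one edge of [M].  The closed cell follows by
    continuity, since [phi] is Lipschitz. *)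
Lemma cell_dilation e c : subinterval (len e) c -> half (len e) c.1 c.2 ->
  (forall r, in_open c.1 c.2 r -> ~ range (@vpt R Gam M) (pt e r)) ->
  exists g, dilation e c g.
Proof.
case: c => a b sc hc nv; have [a0 ab bl] := sc; rewrite /= in hc nv a0 ab bl.
have on_ t : in_cell a b t -> on e t := @on_sub e (a, b) t sc.
pose O_ (i : edge M) := [set t | (ept i @` [set w | (0 < w < len i)%E]) (pt e t)].
have [e1 he1] : exists e1 : edge M, forall t, in_open a b t -> O_ e1 t.
  apply: interval_one_piece => //.
  - by move=> i; apply: open_path => //; exact: open_edge_part.
  - move=> t abt; have [[v E]|[i [w [hw E]]]] := @model_cover _ _ M (pt e t).
      by case: (nv t abt); exists v.
    by exists i, w.
  - move=> i j t [w hw E] [w' hw' E'].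
    by have [] := ept_inj hw hw' (etrans E (esym E')).
have [g0 _] := hdeg e1; exists (deg e1); split=> //= s t hs ht.
have es t0 : in_open a b t0 -> edge_set e1 (pt e t0).
  by move=> /he1[w /= /andP[w0 wl] <-]; exists w => //=; rewrite in_itv/= !ltW.
have main s0 t0 : in_open a b s0 -> in_open a b t0 ->
    image_dist (pt e s0) (pt e t0) = (deg e1)%:R * `|s0 - t0|.
  move=> hs0 ht0; have cs := in_open_cell hs0; have ct := in_open_cell ht0.
  rewrite (image_dist_edge (es _ hs0) (es _ ht0)) ?(@rdist_half _ _ _ e a b)//.
  - exact/pt_finite/on_.
  - exact/pt_finite/on_.
(* main holds on the open cell; its ends are limits of interior points *)
have [m am mb] := ereal_between ab; rewrite lte_fin in am.
(* a point of the open cell at distance eta * |m - u| of the position u *)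
pose app (u eta : R) := u + eta * (m - u).
have app_in u eta : in_cell a b u -> 0 < eta -> eta <= 1 -> in_open a b (app u eta).
  move=> /andP[au ub] eta0 eta1; rewrite /app; apply/andP; split; first by nra.
  have [um|mu] := leP u m.
    by apply: le_lt_trans mb; rewrite lee_fin; nra.
  by apply: lt_le_trans ub; rewrite lte_fin; nra.
have [g1 hg] := hdeg e1.
set g := (deg e1)%:R; have gp : 0 <= g :> R by rewrite ler0n.
apply/eqP; rewrite -subr_eq0; apply/eqP.
apply: (@norm_small _ _ (K * (`|m - s| + `|m - t|) + g * `|s - t|)).
  by rewrite addr_ge0 ?mulr_ge0 ?addr_ge0// ltW ?K_gt0.
move=> eta eta0 eta1.
have hs' := app_in s eta hs eta0 eta1; have ht' := app_in t eta ht eta0 eta1.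
have := main _ _ hs' ht'.
have -> : app s eta - app t eta = (1 - eta) * (s - t) by rewrite /app; ring.
rewrite normrM (@ger0_norm _ (1 - eta)) ?subr_ge0// => E1.
have fs := pt_finite (on_ _ hs); have ft := pt_finite (on_ _ ht).
have fs' := pt_finite (on_ _ (in_open_cell hs')); have ft' := pt_finite (on_ _ (in_open_cell ht')).
have near_ u : in_cell a b u -> image_dist (pt e u) (pt e (app u eta)) <= K * (eta * `|m - u|).
  move=> hu; have hu' := app_in u eta hu eta0 eta1.
  have ou := on_ _ hu; have ou' := on_ _ (in_open_cell hu').
  apply: (le_trans (image_dist_le (pt_finite ou) (pt_finite ou'))).
  rewrite ler_wpM2l ?(ltW K_gt0)// (le_trans (rdist_pt ou ou'))//.
  by rewrite /app opprD addNKr normrN normrM gtr0_norm.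
have n1 := near_ s hs; have n2 := near_ t ht.
have t1 := image_dist_tri fs fs' ft; have t2 := image_dist_tri fs' ft' ft.
have t3 := image_dist_tri fs' fs ft'; have t4 := image_dist_tri fs ft ft'.
rewrite (image_dist_sym (pt e (app t eta)) (pt e t)) in t2.
rewrite (image_dist_sym (pt e (app s eta)) (pt e s)) in t3.
rewrite -/g in E1; rewrite E1 in t2 t3.
have e2 : 0 <= eta * (g * `|s - t|) by rewrite mulr_ge0 ?mulr_ge0// ltW.
by rewrite ler_norml; apply/andP; split; lra.
Qed.

(** The cuts are the middle of the edge and the positions of the vertices of
    [M]. *)
Lemma cuts_model e : exists B : seq R, forall c, subinterval (len e) c ->
  (forall r, r \in B -> ~ in_open c.1 c.2 r) ->
  half (len e) c.1 c.2 /\ exists g, dilation e c g.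
Proof.
have l0 := len_gt0 e.
have fin : finite_set ([set t : R | (0 < t%:E < len e)%E] `&` pt e @^-1` range (@vpt R Gam M)).
  apply: finite_inj_preimage; last by apply: finite_image; exact: finite_finset.
  by move=> s t /= hs ht /(ept_inj hs ht)[_ []].
have [B EB] := (finite_seqP _).1 fin.
exists (fine (len e) / 2 :: B) => c sc nB.
have hc : half (len e) c.1 c.2.
  apply: in_open_half => // r lr; apply: nB.
  by rewrite lr inE eqxx.
split=> //; apply: cell_dilation => // r cr Vr; apply: (nB r) => //.
rewrite inE; apply/orP; right.
have : [set` B] r.
  rewrite -EB; split=> //=; have [a0 ab bl] := sc; case/andP: cr => ar rb.
  by rewrite lte_fin (le_lt_trans a0 ar) (lt_le_trans rb bl).
by [].
Qed.

Lemma dilation_cover e : exists cs : seq (R * \bar R),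
  [/\ forall c, c \in cs -> subinterval (len e) c,
      forall c, c \in cs -> exists g, dilation e c g &
      forall t, on e t -> exists2 c, c \in cs & in_cell c.1 c.2 t].
Proof.
have [B hB] := cuts_model e; have [cs [h1 h2 h3]] := subdivision B (len_gt0 e).
exists cs; split=> // c ccs.
by have [] := hB c (h1 c ccs) (fun r rB => h3 r c rB ccs).
Qed.

Hypothesis ne : ~ singleton_curve Gam.

(** A point at infinity is at distance 0 or +oo of any other point, while a
    finite point lies in a cell whose points have images at positive finite
    distances. *)
Lemma phi_finite x : fpt x -> finpt N' (phi x).
Proof.
move=> fx; have [e0 _] := nonsingleton_edge ne.
have [e [t [ot E]]] := fpt_pt e0 fx.
have [cs [h1 h2 h3]] := dilation_cover e.
have [c ccs ct] := h3 t ot; have sc := h1 c ccs; have [g [g0 hg]] := h2 c ccs.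
have [s cs_ st] : exists2 s, in_cell c.1 c.2 s & s != t.
  have [_ ab _] := sc; have [m am mb] := ereal_between ab.
  have cm : in_cell c.1 c.2 m by apply/andP; rewrite -lee_fin !ltW.
  have ca : in_cell c.1 c.2 c.1 by rewrite /in_cell lexx ltW.
  have [mt|] := eqVneq m t; last by exists m.
  by exists c.1 => //; rewrite -mt lt_eqF// -lte_fin.
have os := on_sub sc cs_.
have fs := pt_finite os; have ft := pt_finite ot.
have := hg s t cs_ ct => hst.
have p : 0 < image_dist (pt e s) (pt e t).
  by rewrite hst mulr_gt0 ?ltr0n// normr_gt0 subr_eq0.
move=> ix; rewrite E in ix.
have [EE|/eqP NE] := eqVneq (phi (pt e s)) (phi (pt e t)).
  by move: p; rewrite /image_dist EE rdist_refl ltxx.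
have := dist_infpt ix NE; rewrite dist_sym phi_dist_fin//.
Qed.

Definition affine_cell e (c : R * \bar R) : Prop :=
  exists (e' : edge N') (k : int) (b : R), forall t, in_open c.1 c.2 t ->
    on e' (k%:~R * t + b) /\ phi (pt e t) = pt e' (k%:~R * t + b).

(** The interior of the cell is connected and its image avoids the ends of the
    half edges of [Gam'], so that it is mapped into one of them.  There
    [phi] is a dilation between intervals. *)
Lemma cell_affine e c : subinterval (len e) c -> (exists g, dilation e c g) ->
  (forall r, in_open c.1 c.2 r -> ~ half_points N' (phi (pt e r))) ->
  affine_cell e c.
Proof.
move=> sc [g [g0 hg]] nv; have [a0 ab bl] := sc.
have [[e' h] hi] : exists i, forall t, in_open c.1 c.2 t ->
    [set t | half_edge (M := N') i (phi (pt e t))] t.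
  apply: interval_one_piece => //.
  - move=> i; apply: (open_path (V := phi @^-1` half_edge (M := N') i)) => //.
    by move/continuousP: cphi; apply; exact: half_edge_open.
  - by move=> t abt; have [i hi] := half_edge_cover (nv t abt); exists i.
  - by move=> i j t; exact: half_edge_disjoint.
have fe t : in_open c.1 c.2 t -> fpt (pt e t).
  by move=> /in_open_cell/(on_sub sc); exact: pt_finite.
have /choice[tau htau] : forall t, exists s : R, in_open c.1 c.2 t ->
   [/\ on e' s, phi (pt e t) = pt e' s & (half_lo (len e') h < s%:E < half_hi (len e') h)%E].
  move=> t; have [abt|] := boolP (in_open c.1 c.2 t); last by exists 0.
  have [s hs] := half_edge_coord (hi t abt) (phi_finite (fe t abt)).
  by exists s.
have [|s t hs ht|k [b hk]] := @dilation_affine _ [set t | in_open c.1 c.2 t] tau g.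
- have [m am mb] := ereal_between ab; have [n mn nb] := ereal_between mb.
  rewrite lte_fin in am; rewrite lte_fin in mn.
  exists m, n; split=> //=; rewrite /in_open ?am ?mb//= nb andbT.
  exact: lt_trans mn.
- have [os Es hs'] := htau s hs; have [ot Et ht'] := htau t ht.
  by rewrite -(rdist_half_edge hs' ht') -Es -Et; apply: hg; exact: in_open_cell.
exists e', k, b => t ht; have [ot Et _] := htau t ht.
by rewrite -hk.
Qed.

(** A dilation is injective, so that each cell of [dilation_cover] contains
    finitely many points above [half_points]; these are the additional cuts. *)
Lemma cells_exist e : exists cs : seq (R * \bar R),
  (forall c, c \in cs -> [/\ subinterval (len e) c, half (len e) c.1 c.2,
      exists g, dilation e c g & affine_cell e c]) /\
  forall t, on e t -> exists2 c, c \in cs & in_cell c.1 c.2 t.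
Proof.
have [B1 hB1] := cuts_model e; have [cs1 [h1 h2 h3]] := dilation_cover e.
have fin : finite_set [set t : R | on e t /\ half_points N' (phi (pt e t))].
  have : finite_set (\bigcup_(c in [set` cs1]) ([set t | in_cell c.1 c.2 t] `&`
      (phi \o pt e) @^-1` half_points N')).
    apply: bigcup_finite; first exact: finite_seq.
    move=> c /= ccs; apply: finite_inj_preimage; last exact: half_points_finite.
    move=> s t /= hs ht E; have [g [g0 hg]] := h2 c ccs.
    have := hg s t hs ht; rewrite /image_dist E rdist_refl => /esym/eqP.
    by rewrite mulf_eq0 pnatr_eq0 gtn_eqF//= normr_eq0 subr_eq0 => /eqP.
  apply: sub_finite_set => t [ot hp]; have [c ccs ct] := h3 t ot.
  by exists c.
have [B2 EB2] := (finite_seqP _).1 fin.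
have [cs [k1 k2 k3]] := subdivision (B1 ++ B2) (len_gt0 e).
exists cs; split=> // c ccs; have sc := k1 c ccs.
have [|hc dc] := hB1 c sc.
  by move=> r rB; apply: k3 => //; rewrite mem_cat rB.
split=> //; apply: cell_affine => // r cr hr; apply: (k3 r c) => //.
rewrite mem_cat; apply/orP; right.
have : [set` B2] r by rewrite -EB2; split=> //; apply: (on_sub sc); exact: in_open_cell.
by [].
Qed.

Lemma pullback_rational f' : rational f' -> rational (f' \o phi).
Proof.
case=> [->|[cf' pf' ff']]; first by left.
right; split.
- by move=> x; apply: continuous_comp; [exact: cphi|exact: cf'].
- move=> e; have f'E (y : Gam') : finpt N' y -> f' y = (fine (f' y))%:E.
    by move=> fy; rewrite fineK//; exact: ff'.
  have H : forall t, (0 <= t%:E <= len e)%E -> (f' \o phi) (pt e t) = (fine (f' (phi (pt e t))))%:E.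
    by move=> t ot; apply/f'E/phi_finite; exact: (pt_finite (ot : on e t)).
  apply/(pia_pl H).2.
  have [cs [hcs cov]] := cells_exist e.
  (* each cell gives an open interval, where phi is affine, and two ends *)
  pose J (i : seq_sub cs * option bool) : set R := match i.2 with
    | None => [set t | in_open (val i.1).1 (val i.1).2 t]
    | Some true => [set (val i.1).1]
    | Some false => [set t | (val i.1).2 = t%:E] end.
  apply: (pl_glue (J := J)) => [t ot|[[c ccs] [[]|]]|[[c ccs] [[]|]]].
  + have [c ccs ct] := cov t ot; have [[_ ab _] _ _ _] := hcs c ccs.
    case: (in_cellP ab ct) => [E|E|io].
    * by exists (SeqSub ccs, Some true); rewrite /J/= E.
    * by exists (SeqSub ccs, Some false); rewrite /J/= E.
    * by exists (SeqSub ccs, None).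
  + by move=> x y /= -> -> z /andP[? ?]; apply/eqP; rewrite eq_le; apply/andP.
  + move=> x y Ex Ey z /andP[xz zy]; have [xy] := etrans (esym Ex) Ey.
    suff -> : z = x by [].
    by apply/eqP; rewrite eq_le xz xy zy.
  + move=> x y /= /andP[ax _] /andP[_ yb] z /andP[xz zy].
    by apply/andP; split; [exact: lt_le_trans ax xz|exact: le_lt_trans yb].
  + by apply: (@pl_set1 _ _ _ c.1) => t [].
  + by apply: (@pl_set1 _ _ _ (fine c.2)) => t [/= _ ->].
  + have [sc _ _ [e' [k [b hkb]]]] := hcs c ccs.
    have H' : forall t, (0 <= t%:E <= len e')%E -> f' (pt e' t) = (fine (f' (pt e' t)))%:E.
      by move=> t ot; apply/f'E; exact: (pt_finite (ot : on e' t)).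
    have := pl_comp_affine (m := k) (c := b) _ ((pia_pl H').1 (pf' e')).
    move=> /(_ [set t | in_open c.1 c.2 t]) h.
    apply: pl_ext (pl_sub _ (h _)) => [t [/= _ io]|t [/= _ //]|t /= io].
      by have [_ ->] := hkb t io.
    by have [] := hkb t io.
- by move=> x fx; apply: ff'; exact: phi_finite.
Qed.

Lemma subsemiring_pullback : subsemiring (pullback_Rat phi).
Proof.
have pr f' : rational f' -> rational (f' \o phi) := @pullback_rational f'.
split.
- by move=> _ [f' rf' <-]; exact: pr.
- by exists (cst -oo%E) => //; left.
- by exists (cst 0%E) => //; exact: rational_cst.
- move=> _ _ [f rf <-] [g rg <-]; exists (rat_add f g) => //; exact: rational_add.
- move=> _ _ [f rf <-] [g rg <-]; exists (rat_mul f g); first exact: rational_mul.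
  apply/esym; apply: rat_mulE; first by apply: pr; exact: rational_mul.
  by move=> x fx /=; rewrite /rat_mul asboolT//; exact: phi_finite.
Qed.
End Dilations.

(** * Generation *)

Lemma nat_above (R : realType) (x : R) : exists n : nat, x <= n%:R.
Proof.
exists (Num.bound `|x|); apply: (le_trans (ler_norm x)); apply: ltW.
by apply: archi_boundP.
Qed.

Section Generation.
Variables (R : realType) (Gam Gam' : tropical_curve R) (phi : Gam -> Gam').
Notation N := (curve_model Gam).
Notation N' := (curve_model Gam').
Notation fpt := (finpt N).
Notation d := (rdist N).
Notation d' := (rdist N').
Hypothesis phi_finite : forall x, fpt x -> finpt N' (phi x).
Variable K : R.
Hypothesis K0 : 0 <= K.
Hypothesis phi_lips : forall x y, fpt x -> fpt y -> d' (phi x) (phi y) <= K * d x y.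
Implicit Types (e : edge N) (u v w : Gam -> R) (f g : Gam -> \bar R).

Section Wedge.
Variables (e : edge N) (c : R * \bar R) (g : nat) (A : set R).
Hypotheses (sc : subinterval (len e) c) (dc : dilation phi e c g).
Hypotheses (iA : is_interval A) (Ac : forall t, A t -> in_cell c.1 c.2 t) (A0 : A !=set0).

(** Let [p] and [q] be the ends of [A] and [g] the dilation factor.  If [q] is
    finite, take [W y = d' y (phi p) + d' y (phi q) - g (q - p)]: at the
    position [s] of the cell its pullback is [g] times [|s - p| + |s - q| -
    (q - p)], twice the distance from [s] to [A].  If [A] is unbounded, the
    cell is a ray starting at [c.1], and the distance to the missing end is
    replaced by a Busemann function, minus the distance to the start of the
    ray. *)
Lemma wedge : exists W : Gam' -> R, [/\ Ratfin N' W,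
  forall t, A t -> W (phi (pt e t)) = 0 &
  forall s eta, in_cell c.1 c.2 s -> 0 < eta ->
    exists2 a, A a & `|s - a| <= W (phi (pt e s)) + eta].
Proof.
have [t0 At0] := A0; have [g0 hg] := dc; have [a0 ab bl] := sc.
have lbA : lbound A c.1 by move=> t /Ac/andP[].
have infA : has_inf A by split; [exists t0|exists c.1].
pose p := inf A.
have pA t : A t -> p <= t by move=> At; apply: inf_lbound => //; exists c.1.
have cp : c.1 <= p by apply: lb_le_inf => //; exists t0.
have pc : in_cell c.1 c.2 p.
  rewrite /in_cell cp /=; have /andP[_] := Ac At0; apply: le_trans.
  by rewrite lee_fin pA.
have fp : finpt N' (phi (pt e p)) by exact/phi_finite/pt_finite/(on_sub sc).
have g1 : 1 <= g%:R :> R by rewrite ler1n.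
have left s eta : s <= p -> 0 < eta -> exists2 a, A a & `|s - a| <= p - s + eta.
  move=> sp eta0; have [a Aa ap] := inf_adherent eta0 infA; rewrite -/p in ap.
  exists a => //; rewrite distrC ger0_norm; first by lra.
  by rewrite subr_ge0 (le_trans sp)// pA.
have above s : p < s -> exists2 a, A a & a < s.
  move=> ps; have sp0 : 0 < s - p by rewrite subr_gt0.
  by have [a Aa] := inf_adherent sp0 infA; rewrite -/p addrC subrK => ?; exists a.
have [supA|nsup] := pselect (has_sup A).
  pose q := sup A.
  have qA t : A t -> t <= q by move=> At; apply: sup_ubound => //; case: supA.
  have qc : in_cell c.1 c.2 q.
    apply/andP; split; first by apply: le_trans (qA _ At0); case/andP: (Ac At0).
    case E : (c.2) => [b||]; rewrite ?leey//; last by move: ab; rewrite E.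
    rewrite lee_fin; apply: sup_le_ub; first by exists t0.
    by move=> t /Ac/andP[_]; rewrite E lee_fin.
  have fq : finpt N' (phi (pt e q)) by exact/phi_finite/pt_finite/(on_sub sc).
  have below s : s < q -> exists2 a, A a & s < a.
    move=> ps; have sp0 : 0 < q - s by rewrite subr_gt0.
    by have [a Aa] := sup_adherent sp0 supA; rewrite -/q opprB addrC subrK => ?; exists a.
  have right s eta : q <= s -> 0 < eta -> exists2 a, A a & `|s - a| <= s - q + eta.
    move=> sp eta0; have [a Aa ap] := sup_adherent eta0 supA; rewrite -/q in ap.
    exists a => //; rewrite ger0_norm; first by lra.
    by rewrite subr_ge0 (le_trans _ sp)// qA.
  have WE s : in_cell c.1 c.2 s -> d' (phi (pt e s)) (phi (pt e p)) +
      d' (phi (pt e s)) (phi (pt e q)) - g%:R * (q - p) = g%:R * (`|s - p| + `|s - q| - (q - p)).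
    by move=> hs; rewrite -/(image_dist phi _ _) -/(image_dist phi _ _) !hg//; ring.
  exists (fun y => d' y (phi (pt e p)) + d' y (phi (pt e q)) - g%:R * (q - p)); split.
  - by apply: Ratfin_add; [apply: Ratfin_add; exact: Ratfin_dist|exact: Ratfin_cst].
  - move=> t At; rewrite WE ?Ac//; have pt_ := pA t At; have tq := qA t At.
    by rewrite ger0_norm ?subr_ge0// distrC ger0_norm ?subr_ge0//; ring.
  - move=> s eta hs eta0; rewrite WE//.
    have pq : p <= q := le_trans (pA _ At0) (qA _ At0).
    have [sp|ps] := leP s p.
      have [a Aa ha] := left s eta sp eta0; exists a => //; apply: (le_trans ha).
      rewrite lerD2r distrC (distrC s) !ger0_norm; [|lra|lra].
      by nra.
    have [qs|sq] := leP q s.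
      have [a Aa ha] := right s eta qs eta0; exists a => //; apply: (le_trans ha).
      rewrite lerD2r !ger0_norm; [|lra|lra].
      by nra.
    have [a1 Aa1 a1s] := above s ps; have [a2 Aa2 sa2] := below s sq.
    exists s; first by apply: (iA Aa1 Aa2); rewrite !ltW.
    rewrite subrr normr0 ger0_norm; last by lra.
    by rewrite ltr0_norm; [nra|lra].
have below s : exists2 a, A a & s < a.
  apply: contrapT => na; apply: nsup; split; first by exists t0.
  exists s => a Aa; rewrite leNgt; apply/negP => sa; apply: na; by exists a.
have c1c : in_cell c.1 c.2 c.1 by rewrite /in_cell lexx ltW.
have fc : finpt N' (phi (pt e c.1)) by exact/phi_finite/pt_finite/(on_sub sc).
have WE s : in_cell c.1 c.2 s -> d' (phi (pt e s)) (phi (pt e p)) +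
    (- d' (phi (pt e s)) (phi (pt e c.1)) + g%:R * (p - c.1)) = g%:R * (`|s - p| - (s - p)).
  move=> hs; rewrite -/(image_dist phi _ _) -/(image_dist phi _ _) !hg// (@ger0_norm _ (s - c.1)).
    by ring.
  by rewrite subr_ge0; case/andP: hs.
exists (fun y => d' y (phi (pt e p)) + (- d' y (phi (pt e c.1)) + g%:R * (p - c.1))); split.
- apply: Ratfin_add; first exact: Ratfin_dist.
  by apply: Ratfin_add; [apply: Ratfin_opp; exact: Ratfin_dist|exact: Ratfin_cst].
- move=> t At; rewrite WE ?Ac//; have pt_ := pA t At.
  by rewrite ger0_norm ?subr_ge0// subrr mulr0.
- move=> s eta hs eta0; rewrite WE//.
  have [sp|ps] := leP s p.
    have [a Aa ha] := left s eta sp eta0; exists a => //; apply: (le_trans ha).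
    rewrite lerD2r distrC !ger0_norm; [|lra].
    by nra.
  have [a1 Aa1 a1s] := above s ps; have [a2 Aa2 sa2] := below s.
  exists s; first by apply: (iA Aa1 Aa2); rewrite !ltW.
  rewrite subrr normr0 ger0_norm; last by lra.
  by rewrite subrr mulr0 add0r ltW.
Qed.
End Wedge.

Variable cells : edge N -> seq (R * \bar R).
Hypothesis cellsP : forall e c, c \in cells e ->
  [/\ subinterval (len e) c, half (len e) c.1 c.2 & exists q : nat, dilation phi e c q].
Hypothesis cells_cover : forall e t, on e t -> exists2 c, c \in cells e & in_cell c.1 c.2 t.
Hypothesis edge_exists : exists e : edge N, True.
Hypothesis sub_pullback : subsemiring (pullback_Rat phi).

Notation psi e := (edge_fun e (tent (len e))).
(** As inverses are not available, both signs of the tents are needed. *)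
Definition generators : set (Gam -> \bar R) :=
  range (fun e => ext N (psi e)) `|` range (fun e => ext N (fun x => - psi e x)) `|`
  \bigcup_(e in setT) ((fun c => ext N (fun x => - cell_dist e c.1 c.2 x)) @` [set` cells e]).

Lemma generators_finite : finite_set generators.
Proof.
rewrite !finite_setU; split; first by split; apply: finite_image; exact: finite_finset.
apply: bigcup_finite; first exact: finite_finset.
by move=> e _; apply: finite_image; exact: finite_seq.
Qed.

Lemma generators_Rat : generators `<=` @Rat R Gam.
Proof.
move=> f [[[e _ <-]|[e _ <-]]|[e _ [c ce <-]]]; apply: rational_ext.
- exact: Ratfin_tent.
- exact/Ratfin_opp/Ratfin_tent.
- by have [[a0 ab bl] _ _] := cellsP ce; exact/Ratfin_opp/Ratfin_cell_dist.
Qed.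

Section Semiring.
Variable B : set (Gam -> \bar R).
Hypotheses (sB : subsemiring B) (B_pull : pullback_Rat phi `<=` B) (B_gen : generators `<=` B).

(** [u] is the restriction to the finite points of an element of [B]. *)
Definition inB u := exists2 f, B f & forall x, fpt x -> f x = (u x)%:E.

Lemma B_rational f : B f -> rational f.
Proof. by case: sB => h _ _ _ _; exact: h. Qed.

Lemma inB_ext u : B (ext N u) -> inB u.
Proof. by exists (ext N u) => // x fx; rewrite ext_finite. Qed.

Lemma inB_add u v : inB u -> inB v -> inB (fun x => u x + v x).
Proof.
case: sB => _ _ _ _ hM [f Bf fE] [g Bg gE]; exists (rat_mul f g); first exact: hM.
by move=> x fx; rewrite /rat_mul asboolT// fE// gE.
Qed.

Lemma inB_pull (W : Gam' -> R) : Ratfin N' W -> inB (fun x => W (phi x)).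
Proof.
move=> rW; exists (ext N' W \o phi).
  by apply: B_pull; exists (ext N' W) => //; exact: rational_ext.
by move=> x fx /=; rewrite ext_finite//; exact: phi_finite.
Qed.

Lemma inB_cst r : inB (fun=> r).
Proof. exact: (inB_pull (Ratfin_cst N' r)). Qed.

Lemma inB_mulrn u (n : nat) : inB u -> inB (fun x => n%:R * u x).
Proof.
move=> hu; elim: n => [|n IH].
  by rewrite (_ : (fun _ => _) = (fun=> 0)); [exact: inB_cst|apply/funext => x; rewrite mul0r].
rewrite (_ : (fun _ => _) = (fun x => u x + n%:R * u x)); first exact: inB_add.
by apply/funext => x; rewrite -natr1; ring.
Qed.

Lemma inB_mulz_tent e (k : int) : inB (fun x => k%:~R * psi e x).
Proof.
case: k => n; first by apply: inB_mulrn; apply/inB_ext/B_gen; left; left; exists e.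
have h : inB (fun x => n.+1%:R * - psi e x).
  by apply: inB_mulrn; apply/inB_ext/B_gen; left; right; exists e.
rewrite (_ : (fun _ => _) = (fun x => n.+1%:R * - psi e x))//.
by apply/funext => x; rewrite NegzE intrN -pmulrn mulrN mulNr.
Qed.

Lemma Ratfin_mulz_tent e (k : int) : Ratfin N (fun x => k%:~R * psi e x).
Proof.
case: k => n; first by apply: Ratfin_mulrn; exact: Ratfin_tent.
have h := Ratfin_opp (Ratfin_mulrn n.+1 (Ratfin_tent e)).
rewrite (_ : (fun _ => _) = (fun x => - (n.+1%:R * psi e x)))//.
by apply/funext => x; rewrite NegzE intrN -pmulrn mulNr.
Qed.

(** With [v = k psi + b - u], [L] a Lipschitz constant of [v] and [s] a point of
    the cell nearest to [x], one has [v x <= v s + L G x] and [v s <= L (W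
    (phi s))] because [v] vanishes on [A], while [W (phi s)] exceeds [W (phi
    x)] by a multiple of [G x] at most. *)
Lemma piece_below u e c (A : set R) : Ratfin N u -> c \in cells e -> is_interval A ->
  A !=set0 -> (forall t, A t -> in_cell c.1 c.2 t) -> affine_on A (fun t => u (pt e t)) ->
  exists w, [/\ inB w, forall x, fpt x -> w x <= u x &
    forall t, A t -> w (pt e t) = u (pt e t)].
Proof.
move=> ru ce iA A0 Ac [k [b hk]]; have [sc hc [g dc]] := cellsP ce; have [a0 ab bl] := sc.
have on_ t : in_cell c.1 c.2 t -> on e t := on_sub sc.
have [W [rW WA WN]] := wedge sc dc iA Ac A0.
have [sg [c0 hsg]] := tent_half bl hc.
pose k' : int := k * (-1) ^+ sg.
pose b' := b - k'%:~R * c0.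
have linA t : A t -> k'%:~R * psi e (pt e t) + b' = u (pt e t).
  move=> At; have ot := on_ t (Ac t At).
  rewrite tent_edge// hsg ?(on_ge0 ot) ?Ac// hk// /b' /k'.
  by case: sg {hsg k' b'} => /=; rewrite ?expr1 ?expr0 ?mulrN1 ?mulr1 ?intrN; ring.
pose v x := k'%:~R * psi e x + b' - u x.
have rv : Ratfin N v.
  apply: Ratfin_add; last exact: Ratfin_opp.
  by apply: Ratfin_add; [exact: Ratfin_mulz_tent|exact: Ratfin_cst].
have vA t : A t -> v (pt e t) = 0 by move=> At; rewrite /v linA// subrr.
have [[L L0 vL] _] := rv; have [[KW KW0 WL] _] := rW.
have [n1 Ln1] := nat_above L; have [n2 hn2] := nat_above (L + n1%:R * (KW * K)).
exists (fun x => k'%:~R * psi e x + b' + (n1%:R * - W (phi x) + n2%:R * - cell_dist e c.1 c.2 x)).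
split.
- apply: inB_add; first by apply: inB_add; [exact: inB_mulz_tent|exact: inB_cst].
  apply: inB_add; apply: inB_mulrn; last first.
    by apply/inB_ext/B_gen; right; exists e => //; exists c.
  exact: (inB_pull (Ratfin_opp rW)).
- move=> x fx; have [s hs dxs] := cell_dist_near e ab fx.
  have fs := pt_finite (on_ s hs).
  have G0 := cell_dist_ge0 e c.1 c.2 x; set G := cell_dist _ _ _ _ in dxs G0 *.
  have W0 : 0 <= W (phi (pt e s)).
    by apply/ler_addgt0Pr => eta eta0; have [a _] := WN s eta hs eta0; exact: le_trans.
  have vs : v (pt e s) <= n1%:R * W (phi (pt e s)).
    apply: (@le_trans _ _ (L * W (phi (pt e s)))); last by rewrite ler_wpM2r.
    apply/ler_addgt0Pr => eta eta0.
    have e0 : 0 < eta / (L + 1) by rewrite divr_gt0// ltr_wpDl.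
    have [a Aa sa] := WN s _ hs e0.
    have := vL e s a (on_ s hs) (on_ a (Ac a Aa)); rewrite (vA a Aa) subr0 => h.
    apply: (le_trans (ler_norm _)); apply: (le_trans h).
    apply: (le_trans (ler_wpM2l L0 sa)); rewrite mulrDr lerD2l mulrA ler_pdivrMr ?ltr_wpDl//.
    by rewrite mulrC ler_wpM2l ?ltW// ltrDl.
  have vx : v x <= v (pt e s) + L * G.
    have := edge_lips_rdist L0 vL fx fs; rewrite ler_norml => /andP[_].
    have := ler_wpM2l L0 dxs; lra.
  have Wx : W (phi (pt e s)) <= W (phi x) + KW * (K * G).
    have := edge_lips_rdist KW0 WL (phi_finite fs) (phi_finite fx).
    rewrite ler_norml => /andP[_]; rewrite rdist_sym.
    have := ler_wpM2l KW0 (phi_lips fx fs).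
    have := ler_wpM2l KW0 (ler_wpM2l K0 dxs); lra.
  have := ler_wpM2l (ler0n R n1) Wx.
  have := ler_wpM2r G0 hn2.
  rewrite /v in vs vx *; lra.
- move=> t At; rewrite WA// cell_dist_in//; last exact: Ac.
  by rewrite linA// oppr0 !mulr0 !addr0.
Qed.

Definition below f g := B g /\ forall x, fpt x -> (g x <= f x)%E.

(** The semiring sum is the maximum: elements of [B] below [f] that reach it on
    different sets combine to one that reaches it on the union. *)
Lemma below_cover f (I : finType) (S : I -> set Gam) :
  (forall i, exists2 g, below f g & forall x, fpt x -> S i x -> g x = f x) ->
  exists2 g, below f g & forall x, fpt x -> (exists i, S i x) -> g x = f x.
Proof.
move=> hS; have /choice[G hG] : forall i, exists g, below f g /\ forall x, fpt x -> S i x -> g x = f x.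
  by move=> i; have [g ? ?] := hS i; exists g.
have bG i := (hG i).1; have GS i := (hG i).2; case: sB => _ hz _ hA _.
suff [g bg gS] : exists2 g, below f g &
    forall i x, i \in enum I -> fpt x -> S i x -> g x = f x.
  by exists g => // x fx [i]; apply: gS => //; rewrite mem_enum.
elim: (enum I) => [|i s [g bg gS]].
  by exists (@rat_zero _ _) => //; split=> // x _; rewrite leNye.
exists (rat_add (G i) g).
  split; first by apply: hA; [case: (bG i)|case: bg].
  by move=> x fx; rewrite /rat_add ge_max (bG i).2//= bg.2.
move=> j x; rewrite inE => /predU1P[->|js] fx Sx.
  by rewrite /rat_add GS// max_l// bg.2.
by rewrite /rat_add (gS j)// max_r// (bG i).2.
Qed.

Lemma Rat_sub_B : @Rat R Gam `<=` B.
Proof.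
move=> f rf; have [fN|nf] := pselect (f = cst -oo%E).
  by rewrite fN; case: sB.
have [ru fE] := Ratfin_fine rf nf; set u := fine \o f in ru.
suff [g [Bg gf] gS] : exists2 g, below f g & forall x, fpt x ->
    (exists e, exists2 t, on e t & x = pt e t) -> g x = f x.
  suff -> : f = g by [].
  apply: rat_eq_finite => //; first exact: B_rational.
  move=> x fx; rewrite gS//; have [e0 _] := edge_exists.
  by have [e [t [ot E]]] := fpt_pt e0 fx; exists e, t.
apply: below_cover => e.
suff [g bg gS] : exists2 g, below f g & forall x, fpt x ->
    (exists c : seq_sub (cells e), exists2 t, in_cell (val c).1 (val c).2 t & x = pt e t) -> g x = f x.
  exists g => // x fx [t ot E]; apply: gS => //.
  by have [c ce ct] := cells_cover ot; exists (SeqSub ce), t.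
apply: below_cover => -[c ce] /=; have [sc _ _] := cellsP ce.
have [I [A [cA iA aA]]] := ru.2 e.
suff [g bg gS] : exists2 g, below f g & forall x, fpt x ->
    (exists i, exists2 t, (A i t /\ in_cell c.1 c.2 t) & x = pt e t) -> g x = f x.
  exists g => // x fx [t ct E]; apply: gS => //.
  by have [i Ai] := cA t (on_sub sc ct); exists i, t.
apply: below_cover => i.
have [[t0 [Ai0 ct0]]|nA] := pselect (exists t, A i t /\ in_cell c.1 c.2 t); last first.
  exists (@rat_zero _ _); first by split; [case: sB|move=> x _; rewrite leNye].
  by move=> x _ [t hAt _]; case: nA; exists t.
have [||||w [[g Bg gE] wu wA]] := @piece_below u e c (A i `&` [set t | in_cell c.1 c.2 t]) ru ce.
- apply: is_intervalI => // x y /= /andP[ax _] /andP[_ yb] z /andP[xz zy].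
  by apply/andP; split; [exact: le_trans ax xz|exact: le_trans yb].
- by exists t0.
- by move=> t [].
- have [k [b hk]] := aA i; exists k, b => t [At ct]; apply: hk; split=> //=.
  exact: on_sub sc ct.
exists g; first by split=> // x fx; rewrite gE// fE// lee_fin wu.
by move=> x fx [t [At ct] E]; rewrite gE// fE// E wA.
Qed.
End Semiring.

Lemma generation : finitely_generated_algebra (pullback_Rat phi).
Proof.
split=> //; exists generators; split.
- exact: generators_finite.
- exact: generators_Rat.
apply/seteqP; split.
  apply: smallest_sub; first exact: subsemiring_Rat.
  move=> f [|]; last exact: generators_Rat.
  by case: sub_pullback => h _ _ _ _; exact: h.
move=> f rf B [sB hB]; apply: Rat_sub_B rf => //.
- by move=> g hg; apply: hB; left.
- by move=> g hg; apply: hB; right.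
Qed.
End Generation.

Lemma singleton_generation (R : realType) (Gam Gam' : tropical_curve R) (phi : Gam -> Gam') :
  singleton_curve Gam -> singleton_curve Gam' ->
  finitely_generated_algebra (pullback_Rat phi).
Proof.
have sfin (C : tropical_curve R) : singleton_curve C -> forall x : C, finpt (curve_model C) x.
  move=> [z hz] x [e [le _]].
  have l1 : (0 < (1 : R)%:E < len e)%E by rewrite le lte_fin ltr01 ltry.
  by have := @ept_neq_vpt _ _ _ e (1 : R)%:E (tgt e) l1; apply; rewrite (hz (ept e _)) (hz (vpt _)).
move=> s1 s2; have f1 := sfin _ s1; have f2 := sfin _ s2.
have [z hz] := s1.
have RatE : pullback_Rat phi = @Rat R Gam.
  apply/seteqP; split=> f.
    move=> [f' [->|[_ _ ff']] <-]; first by left.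
    have -> : f' \o phi = cst (fine (f' (phi z)))%:E.
      by apply/funext => x; rewrite (hz x) /= fineK//; apply: ff'; exact: f2.
    exact: rational_cst.
  case=> [->|[_ _ ff]]; first by exists (cst -oo%E) => //; left.
  exists (cst (fine (f z))%:E); first exact: rational_cst.
  by apply/funext => x; rewrite (hz x) /= fineK//; apply: ff; exact: f1.
rewrite RatE; split; first exact: subsemiring_Rat.
exists set0; split=> //; rewrite setU0; apply/seteqP; split.
  by apply: smallest_sub => //; exact: subsemiring_Rat.
exact: sub_gen_smallest.
Qed.

Theorem proposition1p5 (R : realType) (Gam Gam' : tropical_curve R)
  (phi : Gam -> Gam') (hphi : finite_harmonic phi) :
  finitely_generated_algebra (pullback_Rat phi).
Proof.
case: hphi => cphi [[s1 s2]|[ns [M [M' [deg [isM _ _ _ [_ _ hdeg _]]]]]]].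
  exact: singleton_generation.
have /choice[cells hcells] := cells_exist cphi isM hdeg ns.
apply: (@generation _ _ _ phi _ _ _ _ cells).
- exact: phi_finite isM hdeg ns.
- exact: ltW (K_gt0 deg).
- exact: image_dist_le isM hdeg.
- by move=> e c /((hcells e).1 c)[].
- by move=> e t; exact: (hcells e).2.
- exact: nonsingleton_edge.
- exact: subsemiring_pullback isM hdeg ns.
Qed.
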